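(* Let $w\colon \mathbb{N}\times\mathbb{N}\to\mathbb{R}$ be a nonnegative function satisfying $\sup_{k\ge 0}\sum_{j=0}^{\infty}w(j,k)<\infty$. Define $\vartheta_w$ on $\Gamma$ by $$\vartheta_w(\sigma)=\sum_{j=0}^{\infty}\mathbf{1}_{\sigma}(j)w(j,j)+\sum_{j,k=0}^{\infty}\big(1-\mathbf{1}_{\sigma}(j)\big)\mathbf{1}_{\sigma}(k)w(j,k),\quad \sigma\in\Gamma.$$ Then a vector $\xi\in \mathsf{L}^2(Z)$ belongs to $\mathrm{Dom}\,S_w$ if and only if $$\sum_{\sigma\in\Gamma}\big(\vartheta_w(\sigma)\big)^2|\langle Z_{\sigma},\xi\rangle|^2<\infty .$$ In that case, one has $$S_w\xi=\sum_{\sigma\in\Gamma}\vartheta_w(\sigma)\langle Z_{\sigma},\xi\rangle Z_{\sigma}.$$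
   Context: $\mathbb{N}$ is the set of nonnegative integers and $\Gamma$ the set of all finite subsets of $\mathbb{N}$; $\mathbf{1}_\sigma$ is the indicator function of $\sigma\in\Gamma$. $(\Omega,\mathscr{F},\mathbb{P})$ is a probability space and $Z=(Z_n)_{n\ge0}$ an independent sequence of random variables with $\mathbb{P}\{Z_n=\theta_n\}=p_n$, $\mathbb{P}\{Z_n=-1/\theta_n\}=q_n$, where $0<p_n<1$, $q_n=1-p_n$, $\theta_n=\sqrt{q_n/p_n}$, and $\mathscr{F}$ is the $\sigma$-field generated by $Z$. $\mathsf{L}^2(Z)=L^2(\Omega,\mathscr{F},\mathbb{P})$ (complex-valued), with inner product $\langle\xi,\eta\rangle=\mathbb{E}[\overline{\xi}\eta]$. Put $Z_\emptyset=1$ and $Z_\sigma=\prod_{i\in\sigma}Z_i$; $\{Z_\sigma\mid\sigma\in\Gamma\}$ is an orthonormal basis of $\mathsf{L}^2(Z)$ (the canonical ONB). For $k\in\mathbb{N}$, $\partial_k$ is the bounded operator on $\mathsf{L}^2(Z)$ with $\partial_kZ_\sigma=\mathbf{1}_\sigma(k)Z_{\sigma\setminus\{k\}}$, and its adjoint satisfies $\partial_k^*Z_\sigma=[1-\mathbf{1}_\sigma(k)]Z_{\sigma\cup\{k\}}$, for all $\sigma\in\Gamma$. A double series $\sum_{j,k=0}^\infty\xi_{jk}$ in $\mathsf{L}^2(Z)$ converges naturally if $s_n=\sum_{j=0}^n\sum_{k=0}^n\xi_{jk}$ converges in $\mathsf{L}^2(Z)$ as $n\to\infty$; its sum is then $\lim_n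 s_n$. For nonnegative $w$ with $\sup_{k\ge0}\sum_{j=0}^\infty w(j,k)<\infty$, the 2D-weighted number operator $S_w$ associated with $w$ is $S_w\xi=\sum_{j,k=0}^\infty w(j,k)\partial_k^*\partial_j\partial_j^*\partial_k\xi$, with domain $\mathrm{Dom}\,S_w$ the set of all $\xi\in\mathsf{L}^2(Z)$ for which this double series converges naturally. *)

(* Defs.v *)
From HB Require Import structures.
From mathcomp Require Import all_boot all_order all_algebra finmap ring_quotient.
From mathcomp Require Import generic_quotient.
From mathcomp Require Import complex.
From mathcomp Require Import all_classical all_reals all_analysis measurable_realfun summability.
From mathcomp Require Import ring lra.

Set Implicit Arguments.
Unset Strict Implicit.
Unset Printing Implicit Defensive.

Import Order.TTheory GRing.Theory Num.Theory.
Import numFieldNormedType.Exports.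

Local Open Scope classical_set_scope.
Local Open Scope ring_scope.
Local Open Scope complex_scope.
Local Open Scope quotient_scope.

Section ComplexL2.
Context d (T : measurableType d) (R : realType) (P : probability T R).

(* A function T -> R[i] is square-integrable when its real and imaginary parts
   belong to the library's real-valued space Lfun P 2. *)
Definition L2pred : {pred T -> R[i]} := fun f =>
  ((@complex.Re R) \o f \in Lfun P 2%:E) && ((@complex.Im R) \o f \in Lfun P 2%:E).

Lemma L2predP (f : T -> R[i]) :
  reflect ((@complex.Re R) \o f \in Lfun P 2%:E /\
           (@complex.Im R) \o f \in Lfun P 2%:E) (f \in L2pred).
Proof. exact: andP. Qed.

Let L2_one : (1 <= 2%:E :> \bar R)%E. Proof. by rewrite lee_fin ler1n. Qed.

Let LfunD (f g : T -> R) : f \in Lfun P 2%:E -> g \in Lfun P 2%:E ->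
  f \+ g \in Lfun P 2%:E.
Proof. by move=> fL gL; exact: (Lfun_addr_closed P L2_one).2. Qed.

Let LfunZ (a : R) (f : T -> R) : f \in Lfun P 2%:E ->
  (fun x => a * f x) \in Lfun P 2%:E.
Proof.
move=> fL.
have -> : (fun x => a * f x) = a \o* f by apply/funext => x /=; rewrite mulrC.
by apply: Lfun_scale => //; rewrite ler1n.
Qed.

Let LfunC (a b : R) (f g : T -> R) : f \in Lfun P 2%:E -> g \in Lfun P 2%:E ->
  (fun x => a * f x + b * g x) \in Lfun P 2%:E.
Proof. by move=> fL gL; apply: (LfunD (LfunZ a fL) (LfunZ b gL)). Qed.

Lemma L2pred_submod_closed : submod_closed L2pred.
Proof.
split.
  apply/L2predP; split.
    exact: (Lfun_addr_closed P L2_one).1.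
  exact: (Lfun_addr_closed P L2_one).1.
move=> a f g /L2predP[fr fi] /L2predP[gr gi]; apply/L2predP; split.
  have -> : (@complex.Re R) \o (a *: f + g) =
      (fun x => complex.Re a * complex.Re (f x) + (- complex.Im a) * complex.Im (f x))
      \+ (@complex.Re R \o g).
    apply/funext => x /=; rewrite !fctE /=.
    by case: a (f x) (g x) => [a1 a2] [f1 f2] [g1 g2] /=; rewrite mulNr.
  by apply: LfunD => //; apply: LfunC.
have -> : (@complex.Im R) \o (a *: f + g) =
    (fun x => complex.Re a * complex.Im (f x) + (complex.Im a) * complex.Re (f x))
    \+ (@complex.Im R \o g).
  apply/funext => x /=; rewrite !fctE /=.
  by case: a (f x) (g x) => [a1 a2] [f1 f2] [g1 g2] /=; rewrite (mulrC a2).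
by apply: LfunD => //; apply: LfunC.
Qed.

HB.instance Definition _ :=
  GRing.isSubmodClosed.Build R[i] (T -> R[i]) L2pred L2pred_submod_closed.

Record L2fun := MkL2fun { L2fun_val :> T -> R[i]; L2funP : L2fun_val \in L2pred }.

HB.instance Definition _ := [isSub for L2fun_val].
HB.instance Definition _ := [Choice of L2fun by <:].
HB.instance Definition _ := [SubChoice_isSubLmodule of L2fun by <:].

Definition L2null : {pred L2fun} :=
  fun f => `[< (f : T -> R[i]) = cst 0 %[ae P] >].

Lemma L2nullP (f : L2fun) :
  reflect ((f : T -> R[i]) = cst 0 %[ae P]) (f \in L2null).
Proof. exact: asboolP. Qed.

Lemma L2null_zmod_closed : zmod_closed L2null.
Proof.
split; first by apply/L2nullP; apply: nearW.
move=> f g /L2nullP f0 /L2nullP g0; apply/L2nullP.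
by apply: filterS2 f0 g0 => x /= /(_ I) f0 /(_ I) g0 _; rewrite !fctE /= f0 g0 subr0.
Qed.

HB.instance Definition _ := GRing.isZmodClosed.Build L2fun L2null L2null_zmod_closed.

(* The space L^2 of almost-everywhere classes. *)
Definition L2 := {ideal_quot L2null}.
HB.instance Definition _ := GRing.Zmodule.on L2.
HB.instance Definition _ := EqQuotient.on L2.

Definition L2class (f : L2fun) : L2 := \pi_L2 f.
Definition L2repr (x : L2) : L2fun := repr x.

Lemma L2reprK : cancel L2repr L2class.
Proof. exact: reprK. Qed.

Lemma L2class_eq (f g : L2fun) :
  L2class f = L2class g <-> (f : T -> R[i]) = g %[ae P].
Proof.
have -> : (L2class f = L2class g) <-> f - g \in L2null.
  by rewrite Quotient.idealrBE; split => [fg|/eqP]; first exact/eqP.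
split => [/L2nullP|fg]; last apply/L2nullP.
  by apply: filterS => x /(_ I) /= /eqP; rewrite !fctE /= subr_eq0 => /eqP.
by apply: filterS fg => x /= /(_ I) fg _; rewrite !fctE /= fg subrr.
Qed.

Lemma L2class_repr (f : L2fun) : (L2repr (L2class f) : T -> R[i]) = f %[ae P].
Proof. by apply/L2class_eq; rewrite L2reprK. Qed.

Lemma L2classD (f g : L2fun) : L2class (f + g) = L2class f + L2class g.
Proof. by rewrite /L2class raddfD. Qed.

Definition L2scale (a : R[i]) (x : L2) : L2 := L2class (a *: L2repr x).

Lemma L2scale_class a f : L2scale a (L2class f) = L2class (a *: f).
Proof.
apply/L2class_eq; apply: filterS (L2class_repr f) => x /= /(_ I) fx _.
by rewrite !fctE /= fx.
Qed.

Lemma L2ind (Q : L2 -> Prop) : (forall f, Q (L2class f)) -> forall x, Q x.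
Proof. by move=> Qf x; rewrite -(L2reprK x). Qed.

Lemma L2scalerA a b x : L2scale a (L2scale b x) = L2scale (a * b) x.
Proof. by elim/L2ind: x => f; rewrite !L2scale_class scalerA. Qed.

Lemma L2scale1r : left_id 1 L2scale.
Proof. by elim/L2ind => f; rewrite L2scale_class scale1r. Qed.

Lemma L2scalerDr : right_distributive L2scale +%R.
Proof.
move=> a; elim/L2ind => f; elim/L2ind => g.
by rewrite -L2classD !L2scale_class scalerDr L2classD.
Qed.

Lemma L2scalerDl x : {morph L2scale^~ x : a b / a + b}.
Proof.
by move=> a b; elim/L2ind: x => f; rewrite !L2scale_class scalerDl L2classD.
Qed.

HB.instance Definition _ := GRing.Zmodule_isLmodule.Build R[i] L2
  L2scalerA L2scale1r L2scalerDr L2scalerDl.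

Lemma L2classZ a (f : L2fun) : L2class (a *: f) = a *: L2class f.
Proof. by rewrite -L2scale_class. Qed.

Definition Cexpectation (X : T -> R[i]) : R[i] :=
  fine 'E_P[@complex.Re R \o X] +i* fine 'E_P[@complex.Im R \o X].

(* <f, g> = E[conj f * g]: conjugate-linear in the first argument. *)
Definition L2funinner (f g : T -> R[i]) : R[i] :=
  Cexpectation (fun x => (f x)^*%C * g x).

Definition L2inner (x y : L2) : R[i] := L2funinner (L2repr x) (L2repr y).

Let e (u v : T -> R) : R := fine 'E_P[u \* v].

Let eC u v : e u v = e v u.
Proof. by rewrite /e; congr (fine 'E_P[_]); apply/funext => x /=; rewrite mulrC. Qed.

Let eL u a b v w : u \in Lfun P 2%:E -> v \in Lfun P 2%:E -> w \in Lfun P 2%:E ->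
  e u (fun x => a * v x + b * w x) = a * e u v + b * e u w.
Proof.
move=> uL vL wL; rewrite /e.
have aL c (z : T -> R) : z \in Lfun P 2%:E -> c \o* (u \* z) \in Lfun P 1.
  by move=> zL; apply: Lfun_scale => //; apply: Lfun2_mul_Lfun1.
have -> : u \* (fun x => a * v x + b * w x) = (a \o* (u \* v)) \+ (b \o* (u \* w)).
  by apply/funext => x /=; rewrite mulrDr !(mulrCA (u x)) !(mulrC (u x * _)).
rewrite expectationD ?aL// !expectationZl ?Lfun2_mul_Lfun1//.
rewrite fineD ?fin_numM ?expectation_fin_num ?Lfun2_mul_Lfun1//.
by rewrite !fineM// expectation_fin_num// Lfun2_mul_Lfun1.
Qed.

Let e_ge0 u : 0 <= e u u.
Proof. by apply: fine_ge0; apply: expectation_ge0 => x /=; rewrite -expr2 sqr_ge0. Qed.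

Let e_ae u v u' v' : u \in Lfun P 2%:E -> v \in Lfun P 2%:E ->
  u' \in Lfun P 2%:E -> v' \in Lfun P 2%:E ->
  u = u' %[ae P] -> v = v' %[ae P] -> e u v = e u' v'.
Proof.
move=> uL vL uL' vL' uu vv; rewrite /e unlock; congr fine.
apply: ae_eq_integral => //.
- exact: (measurable_int P ((Lfun1_integrable _ _).1 (Lfun2_mul_Lfun1 uL vL))).
- exact: (measurable_int P ((Lfun1_integrable _ _).1 (Lfun2_mul_Lfun1 uL' vL'))).
- by apply: filterS2 uu vv => x /= /(_ I) -> /(_ I) ->.
Qed.

Let e_eq0 u : u \in Lfun P 2%:E -> e u u = 0 -> u = cst 0 %[ae P].
Proof.
move=> uL /eqP; rewrite /e fine_eq0 ?expectation_fin_num ?Lfun2_mul_Lfun1//.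
move=> /eqP; rewrite unlock => u0.
have mu := measurable_int P ((Lfun1_integrable _ _).1 (Lfun2_mul_Lfun1 uL uL)).
have : (\int[P]_w `|((u \* u) w)%:E|)%E = 0%E.
  rewrite -u0; apply: eq_integral => x _.
  by rewrite gee0_abs// lee_fin /= -expr2 sqr_ge0.
move=> /(ae_eq_integral_abs P measurableT mu).
apply: filterS => x /(_ I) [] /eqP; rewrite -expr2 sqrf_eq0 => /eqP ux _.
exact: ux.
Qed.

Let re (f : T -> R[i]) : T -> R := @complex.Re R \o f.
Let im (f : T -> R[i]) : T -> R := @complex.Im R \o f.

Let reL (f : L2fun) : re f \in Lfun P 2%:E.
Proof. by have /L2predP[] := L2funP f. Qed.

Let imL (f : L2fun) : im f \in Lfun P 2%:E.
Proof. by have /L2predP[] := L2funP f. Qed.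

Let L2funinnerE (f g : L2fun) : L2funinner f g =
  (e (re f) (re g) + e (im f) (im g)) +i* (e (re f) (im g) - e (im f) (re g)).
Proof.
rewrite /L2funinner /Cexpectation; congr (_ +i* _).
  rewrite -fineD ?expectation_fin_num ?Lfun2_mul_Lfun1 ?reL ?imL//.
  rewrite -expectationD ?Lfun2_mul_Lfun1 ?reL ?imL//.
  congr (fine 'E_P[_]); apply/funext => x /=; rewrite /re /im /=.
  by case: (f x) (g x) => [a b] [a' b'] /=; rewrite mulNr opprK.
rewrite -fineB ?expectation_fin_num ?Lfun2_mul_Lfun1 ?reL ?imL//.
rewrite -expectationB ?Lfun2_mul_Lfun1 ?reL ?imL//.
congr (fine 'E_P[_]); apply/funext => x /=; rewrite /re /im /=.
by case: (f x) (g x) => [a b] [a' b'] /=; rewrite mulNr.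
Qed.

Lemma L2inner_class (f g : L2fun) : L2inner (L2class f) (L2class g) = L2funinner f g.
Proof.
have h (k : L2fun) : re (L2repr (L2class k)) = re k %[ae P] /\
    im (L2repr (L2class k)) = im k %[ae P].
  by split; apply: filterS (L2class_repr k) => x /= /(_ I) kx _; rewrite /re /im /= kx.
have [[rf if_] [rg ig]] := (h f, h g).
rewrite /L2inner !L2funinnerE.
by congr ((_ + _) +i* (_ - _)); apply: e_ae => //; solve [exact: reL | exact: imL].
Qed.

Let reZD a (f g : L2fun) :
  re (a *: f + g) = (fun x => 1 * (fun x => complex.Re a * re f x + (- complex.Im a) * im f x) x + 1 * re g x).
Proof.
apply/funext => x; rewrite /re /im /= !fctE /=.
by case: a (f x) (g x) => [a1 a2] [f1 f2] [g1 g2] /=; rewrite !mul1r mulNr.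
Qed.

Let imZD a (f g : L2fun) :
  im (a *: f + g) = (fun x => 1 * (fun x => complex.Re a * im f x + complex.Im a * re f x) x + 1 * im g x).
Proof.
apply/funext => x; rewrite /re /im /= !fctE /=.
by case: a (f x) (g x) => [a1 a2] [f1 f2] [g1 g2] /=; rewrite !mul1r (mulrC a2).
Qed.

Lemma L2innerDZr (a : R[i]) (x y z : L2) :
  L2inner x (a *: y + z) = a * L2inner x y + L2inner x z.
Proof.
elim/L2ind: x => f; elim/L2ind: y => g; elim/L2ind: z => h.
rewrite -L2classZ -L2classD !L2inner_class !L2funinnerE reZD imZD.
rewrite !eL ?reL ?imL ?LfunC ?reL ?imL//.
case: a => a b /=; apply/eqP; rewrite eq_complex /=; apply/andP.
by split; apply/eqP; ring.
Qed.

Lemma L2innerC (x y : L2) : L2inner y x = (L2inner x y)^*%C.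
Proof.
elim/L2ind: x => f; elim/L2ind: y => g; rewrite !L2inner_class !L2funinnerE /=.
rewrite (eC (re g) (re f)) (eC (im g) (im f)) (eC (re g)) (eC (im g)).
by rewrite opprB.
Qed.

Lemma L2inner_Im (x : L2) : complex.Im (L2inner x x) = 0.
Proof.
elim/L2ind: x => f; rewrite L2inner_class L2funinnerE /=.
by rewrite (eC (re f)) subrr.
Qed.

Lemma L2inner_ge0 (x : L2) : 0 <= complex.Re (L2inner x x).
Proof. by elim/L2ind: x => f; rewrite L2inner_class L2funinnerE /= addr_ge0. Qed.

Lemma L2inner_eq0 (x : L2) : complex.Re (L2inner x x) = 0 -> x = 0.
Proof.
elim/L2ind: x => f; rewrite L2inner_class L2funinnerE /= => /eqP.
rewrite paddr_eq0// => /andP[/eqP/e_eq0 rf0 /eqP/e_eq0 if0].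
have -> : 0 = L2class 0 by rewrite /L2class raddf0.
apply/L2class_eq; apply: filterS2 (rf0 (reL f)) (if0 (imL f)).
move=> t /(_ I) r0 /(_ I) i0 _; apply/eqP; rewrite eq_complex.
by move: r0 i0; rewrite /re /im /= => -> ->; rewrite eqxx.
Qed.

(* The norm takes its values in R[i], as required of a normed R[i]-module. *)
Definition L2norm (x : L2) : R[i] := (Num.sqrt (complex.Re (L2inner x x)))%:C.

Let L2innerr0 (x : L2) : L2inner x 0 = 0.
Proof.
by have := L2innerDZr (-1) x x x; rewrite scaleN1r addNr mulN1r addNr.
Qed.

Let L2innerDr (x y z : L2) : L2inner x (y + z) = L2inner x y + L2inner x z.
Proof. by rewrite -[y]scale1r L2innerDZr mul1r scale1r. Qed.

Let L2innerZr a (x y : L2) : L2inner x (a *: y) = a * L2inner x y.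
Proof. by rewrite -[a *: y]addr0 L2innerDZr L2innerr0 addr0. Qed.

Let L2innerDl (x y z : L2) : L2inner (x + y) z = L2inner x z + L2inner y z.
Proof.
by rewrite (L2innerC z (x + y)) (L2innerC z x) (L2innerC z y) L2innerDr rmorphD.
Qed.

Let L2innerZl a (x y : L2) : L2inner (a *: x) y = a^*%C * L2inner x y.
Proof. by rewrite (L2innerC y (a *: x)) (L2innerC y x) L2innerZr rmorphM. Qed.

Let b (x y : L2) : R := complex.Re (L2inner x y).

Let bC x y : b x y = b y x.
Proof. by rewrite /b (L2innerC y x); case: (L2inner _ _). Qed.

Let L2_CauchySchwarz x y : b x y <= Num.sqrt (b x x) * Num.sqrt (b y y).
Proof.
have [y0|yn0] := eqVneq (b y y) 0.
  by rewrite (L2inner_eq0 y0) /b !L2innerr0 /= sqrtr0 mulr0.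
have yp : 0 < b y y by rewrite lt_neqAle eq_sym yn0 L2inner_ge0.
rewrite -sqrtrM ?L2inner_ge0//; apply: le_trans (ler_norm _) _.
rewrite -sqrtr_sqr ler_wsqrtr//.
have := L2inner_ge0 ((b y y)%:C *: x + (- b x y)%:C *: y).
rewrite !L2innerDr !L2innerDl !L2innerZr !L2innerZl.
have := L2inner_Im x; have := L2inner_Im y; have := bC x y; move: yp; rewrite /b.
case: (L2inner x x) (L2inner y y) (L2inner x y) (L2inner y x)
  => [a1 a2] [b1 b2] [c1 c2] [d1 d2] /= yp <- -> ->.
rewrite !(mul0r, mulr0, subr0, addr0, oppr0, mulNr, mulrN, opprK) => H.
rewrite -(ler_pM2l yp); rewrite -subr_ge0.
by apply: le_trans H _; rewrite le_eqVlt; apply/orP; left; apply/eqP; ring.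
Qed.

Lemma L2normD x y : L2norm (x + y) <= L2norm x + L2norm y.
Proof.
rewrite /L2norm -rmorphD /= lecR -!/(b _ _).
have h : b (x + y) (x + y) <= (Num.sqrt (b x x) + Num.sqrt (b y y)) ^+ 2.
  have -> : b (x + y) (x + y) = b x x + b x y + (b y x + b y y).
    by rewrite /b L2innerDl !L2innerDr !raddfD.
  rewrite (bC y x).
  rewrite sqrrD !sqr_sqrtr ?L2inner_ge0// mulr2n.
  have := L2_CauchySchwarz x y; lra.
apply: le_trans (ler_wsqrtr h) _.
by rewrite sqrtr_sqr ger0_norm ?addr_ge0 ?sqrtr_ge0.
Qed.

Lemma L2normZ a x : L2norm (a *: x) = `|a| * L2norm x.
Proof.
rewrite /L2norm L2innerZl L2innerZr normc_def -rmorphM -sqrtrM ?addr_ge0 ?sqr_ge0//.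
congr ((Num.sqrt _)%:C).
have := L2inner_Im x; case: (L2inner x x) a => [c1 c2] [a1 a2] /= ->.
ring.
Qed.

Lemma L2norm_eq0 x : L2norm x = 0 -> x = 0.
Proof.
move=> /(congr1 (@complex.Re R)) /= /eqP; rewrite sqrtr_eq0 => x0.
by apply: L2inner_eq0; apply/eqP; rewrite eq_le x0 L2inner_ge0.
Qed.

HB.instance Definition _ := @Lmodule_isNormed.Build R[i] L2
  L2norm L2normD L2normZ L2norm_eq0.

End ComplexL2.

Section Noise.
Context d (T : measurableType d) (R : realType) (P : probability T R).

(* Mutual independence of a sequence: the product rule over every finite
   subfamily. *)
Definition independent_seq (Z : nat -> {RV P >-> R}) : Prop :=
  forall (s : {fset nat}) (B : nat -> set R), (forall i, measurable (B i)) ->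
  P (\bigcap_(i in [set` s]) (Z i @^-1` B i)) =
  (\prod_(i <- s) P (Z i @^-1` B i))%E.

Definition sigma_of_seq (Z : nat -> {RV P >-> R}) : set (set T) :=
  <<s \bigcup_n preimage_set_system setT (Z n) measurable >>.

Definition Bernoulli_theta (p : nat -> R) (n : nat) : R :=
  Num.sqrt ((1 - p n) / p n).

Definition Zprod (Z : nat -> {RV P >-> R}) (s : {fset nat}) : T -> R[i] :=
  fun x => (\prod_(i <- s) Z i x)%:C.

(* The default value 0 of insubd is not used: see ZbasisE. *)
Definition Zbasis (Z : nat -> {RV P >-> R}) (s : {fset nat}) : L2 P :=
  L2class (insubd 0 (Zprod Z s)).

Section Zprod_L2.
Variables (Z : nat -> {RV P >-> R}) (p : nat -> R).
Hypothesis p01 : forall n, 0 < p n < 1.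
Hypothesis Ztheta : forall n,
  P [set x | Z n x = Bernoulli_theta p n] = (p n)%:E.
Hypothesis ZNtheta : forall n,
  P [set x | Z n x = - (Bernoulli_theta p n)^-1] = (1 - p n)%:E.

Let Z_bounded n : exists C : R, {ae P, forall x, `|Z n x| <= C}.
Proof.
set t := Bernoulli_theta p n.
have t0 : 0 < t.
  by have /andP[? ?] := p01 n; rewrite sqrtr_gt0 divr_gt0// subr_gt0.
exists (Num.max `|t| `|- t^-1|).
pose A := Z n @^-1` [set t] `|` Z n @^-1` [set - t^-1].
have mZ c : measurable (Z n @^-1` [set c]).
  by rewrite -[_ @^-1` _]setTI; exact: measurable_funPT.
exists (~` A); split; first by apply: measurableC; exact: measurableU.
  rewrite probability_setC; last exact: measurableU.
  rewrite measureU//.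
    have e1 : P (Z n @^-1` [set t]) = (p n)%:E := Ztheta n.
    have e2 : P (Z n @^-1` [set - t^-1]) = (1 - p n)%:E := ZNtheta n.
    rewrite [X in (_ - X)%E](_ : _ = 1%E) ?subee//.
    transitivity ((p n)%:E + (1 - p n)%:E)%E; last by rewrite -EFinD addrC subrK.
    by congr (_ + _)%E; [exact: e1|exact: e2].
  apply/seteqP; split => x //= -[-> tt].
  have : 0 < - t^-1 by rewrite -tt.
  by rewrite oppr_gt0 invr_lt0 ltNge (ltW t0).
by move=> x /= h Ax; apply: h; rewrite le_max; case: Ax => /= ->; rewrite lexx ?orbT.
Qed.

Let prod_bounded (s : seq nat) :
  exists C : R, {ae P, forall x, `|\prod_(i <- s) Z i x| <= C}.
Proof.
elim: s => [|n s [C sC]].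
  by exists 1; apply: aeW => x; rewrite big_nil normr1.
have [C' nC] := Z_bounded n; exists (C' * C).
by apply: filterS2 sC nC => x sC nC; rewrite big_cons normrM ler_pM.
Qed.

Lemma Zprod_L2 (s : {fset nat}) : Zprod Z s \in L2pred P.
Proof.
apply/L2predP; split; last exact: (Lfun_cst P 0 2).
have ms : measurable_fun setT (fun x => \prod_(i <- s) Z i x).
  by apply: measurable_prod => i _.
rewrite inE; apply/andP; split; rewrite inE//=.
have [C sC] := prod_bounded s.
rewrite /finite_norm unlock poweR_lty//=.
apply: (@le_lt_trans _ _ (\int[P]_x (`|C| `^ 2)%:E)%E).
  apply: ae_ge0_le_integral => //.
  - apply/measurable_EFinP.
    apply: (@measurableT_comp _ _ _ _ _ _ (fun x : R => x `^ 2)%R) => //.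
    exact: measurableT_comp.
  - apply: filterS sC => x sC _; rewrite lee_fin.
    apply: ge0_ler_powR; rewrite ?nnegrE//.
    by apply: (le_trans sC); exact: ler_norm.
by rewrite integral_cst//= probability_setT mule1 ltry.
Qed.

Lemma ZbasisE (s : {fset nat}) : Zbasis Z s = L2class (MkL2fun (Zprod_L2 s)).
Proof. by congr L2class; apply: val_inj; rewrite val_insubd Zprod_L2. Qed.

End Zprod_L2.

Definition is_adjoint (A B : L2 P -> L2 P) : Prop :=
  forall x y, L2inner (B x) y = L2inner x (A y).

Definition bounded_operator (A : L2 P -> L2 P) : Prop :=
  linear A /\ exists M : R[i], forall x, `|A x| <= M * `|x|.

End Noise.

Section NaturalConvergence.
Context (K : numFieldType) (V : normedModType K).

Definition square_partial_sum (x : nat -> nat -> V) : nat -> V :=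
  fun n => \sum_(j < n.+1) \sum_(k < n.+1) x j k.

Definition converges_naturally (x : nat -> nat -> V) : Prop :=
  cvgn (square_partial_sum x).

Definition natural_sum (x : nat -> nat -> V) : V := limn (square_partial_sum x).

End NaturalConvergence.

Section NumberOperator.
Context d (T : measurableType d) (R : realType) (P : probability T R).
Variables (D Dadj : nat -> L2 P -> L2 P) (w : nat -> nat -> R).

Definition Sw_term (x : L2 P) (j k : nat) : L2 P :=
  (w j k)%:C *: Dadj k (D j (Dadj j (D k x))).

Definition DomSw : set (L2 P) := [set x | converges_naturally (Sw_term x)].

(* Meaningful on DomSw only. *)
Definition Sw (x : L2 P) : L2 P := natural_sum (Sw_term x).

End NumberOperator.

Section Vartheta.
Context (R : realType).
Variable w : nat -> nat -> R.

Definition evartheta (s : {fset nat}) : \bar R :=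
  (\esum_(j in [set: nat]) (((j \in s)%:R * w j j)%:E) +
   \esum_(jk in [set: nat * nat])
      (((1 - (jk.1 \in s)%:R) * (jk.2 \in s)%:R * w jk.1 jk.2)%:E))%E.

Definition vartheta (s : {fset nat}) : R := fine (evartheta s).

(* Hence the values of vartheta are not affected by the default of fine. *)
Lemma evartheta_fin_num (s : {fset nat}) :
  (forall j k, 0 <= w j k) ->
  (ereal_sup [set \sum_(0 <= j <oo) (w j k)%:E | k in [set: nat]] < +oo)%E ->
  evartheta s \is a fin_num.
Proof.
move=> w0 wsup.
have w1 k : (\esum_(j in [set: nat]) (w j k)%:E < +oo)%E.
  rewrite -nneseries_esumT => [|j]; last by rewrite lee_fin.
  by apply: le_lt_trans wsup; apply: ereal_sup_ubound; exists k.
have es (a : nat -> \bar R) : (forall j, 0 <= a j)%E ->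
    (\esum_(j in [set: nat]) (if j \in s then a j else 0) = \sum_(j <- s) a j)%E.
  move=> a0; rewrite fsbig_seq ?fset_uniq//.
  rewrite -esum_fset//=.
  by rewrite [RHS]esum_mkcond; apply: eq_esum => j _; rewrite mem_setE.
rewrite ge0_fin_numE; last first.
  apply: adde_ge0; apply: esum_ge0 => x _; rewrite lee_fin !mulr_ge0//.
  by case: (_ \in s); rewrite ?subrr ?subr0.
rewrite /evartheta lte_add_pinfty//.
  under eq_esum => j _.
    rewrite (_ : (_ * _)%:E = if j \in s then (w j j)%:E else 0%E); last first.
      by case: (j \in s); rewrite ?mul1r ?mul0r.
    over.
  by rewrite es => [|j]; [rewrite sumEFin ltry|rewrite lee_fin].
pose a (j k : nat) : \bar R := if k \in s then (w j k)%:E else 0%E.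
apply: (@le_lt_trans _ _ (\esum_(jk in [set: nat] `*`` (fun=> [set: nat])) a jk.1 jk.2)).
  rewrite (_ : _ `*`` _ = setT); last by apply/seteqP; split.
  apply: le_esum => -[j k] _; rewrite /a /=.
  case: (k \in s); rewrite ?mulr0 ?mul0r// mulr1 lee_fin ler_piMl//.
rewrite -(@esum_esum _ _ _ _ (fun=> setT) a); last first.
  by move=> j k _ _; rewrite /a; case: ifP; rewrite ?lee_fin.
under eq_esum => j _.
  rewrite es; last by move=> k; rewrite lee_fin.
  over.
rewrite esum_sum; last by move=> *; rewrite lee_fin.
by apply: lte_sum_pinfty.
Qed.

End Vartheta.

(* Main.v *)
(* Write c_s = <Z_s, xi>. Each term w(j,k) D_k^* D_j D_j^* D_k is diagonal in the
   basis (Z_s), so that the square partial sum s_n has coefficients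
   theta_n(s) c_s, where theta_n(s) is nonnegative and increases to
   vartheta_w(s). If s_n converges, its limit has coefficients vartheta_w(s) c_s,
   which are square-summable by Bessel's inequality. Conversely, if they are
   square-summable, Riesz-Fischer gives a vector y with these coefficients, and
   |y - s_n|^2 = sum_s (vartheta_w(s) - theta_n(s))^2 |c_s|^2 tends to 0 by
   dominated convergence.
   That (Z_s) is an orthonormal basis has to be proved: orthonormality comes from
   independence, and totality from a pi-lambda argument, the indicator of a
   cylinder event being almost surely a polynomial in the Z_i. *)

Require Import Defs.
From HB Require Import structures.
From mathcomp Require Import all_boot all_order all_algebra finmap.
From mathcomp Require Import complex.
From mathcomp Require Import all_classical all_reals all_analysis measurable_realfun summability.
From mathcomp Require Import ring lra.

Set Implicit Arguments.
Unset Strict Implicit.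
Unset Printing Implicit Defensive.

Import Order.TTheory GRing.Theory Num.Theory.
Import numFieldNormedType.Exports.

Local Open Scope classical_set_scope.
Local Open Scope ring_scope.
Local Open Scope complex_scope.

(** * Completeness of real L^2 *)

Section RealL2.
Context d (T : measurableType d) (R : realType).
Variable mu : {measure set T -> \bar R}.

Lemma Lfun_measurable (f : T -> R) p : f \in Lfun mu p -> measurable_fun setT f.
Proof. by rewrite inE => /andP[/[!inE]]. Qed.

Lemma integrable_sqr_Lfun2 (f : T -> R) : measurable_fun setT f ->
  (\int[mu]_x ((f x) ^+ 2)%:E < +oo)%E -> f \in Lfun mu 2%:E.
Proof.
move=> mf f2; rewrite inE; apply/andP; split; rewrite inE//=.
rewrite /finite_norm unlock poweR_lty//=.
under eq_integral => x _ do rewrite /= powR_mulrn// real_normK ?num_real//.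
exact: f2.
Qed.

(** The sequence is its initial value plus a telescoping series, dominated by a geometric series of
    ratio 1/2. *)
Lemma telescope_geometric_cvg (v : nat -> R) (M : R) : 0 <= M ->
  (forall k, `|v k.+1 - v k| <= M * 2^-1 ^+ k) -> cvgn v.
Proof.
move=> M0 vM.
have cs : cvgn (series (telescope v)).
  apply: normed_cvg; apply: (@series_le_cvg _ _ (geometric M 2^-1)) => //.
  - by move=> n; exact: normr_ge0.
  - by move=> n; rewrite /geometric /= mulr_ge0// exprn_ge0.
  - by apply: is_cvg_geometric_series; rewrite gtr0_norm// invf_lt1// ltr1n.
rewrite (_ : v = fun n => v 0%N + series (telescope v) n); last first.
  by apply/funext => n; rewrite telescopeK /= addrC subrK.
by apply: is_cvgD => //; exact: is_cvg_cst.
Qed.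

(* Almost surely sum_k 4^k (v_(k+1) - v_k)^2 is finite, so that the increments
   decay geometrically. *)
Lemma ae_cvg_rapid (v : nat -> T -> R) : (forall n, measurable_fun setT (v n)) ->
  (forall k, \int[mu]_x ((v k.+1 x - v k x) ^+ 2)%:E <=
     (4^-1 ^+ k * (1 / (2 ^ k.+1)%:R))%:E)%E ->
  {ae mu, forall x, cvgn (v ^~ x)}.
Proof.
move=> mv vk.
pose h k x := (4 ^+ k * (v k.+1 x - v k x) ^+ 2)%:E.
have h0 k x : (0 <= h k x)%E by rewrite lee_fin mulr_ge0 ?sqr_ge0// exprn_ge0.
have mdv k : measurable_fun setT (fun x => (v k.+1 x - v k x) ^+ 2).
  by apply: measurable_funX; exact: measurable_funB.
have mh k : measurable_fun setT (h k).
  by apply/measurable_EFinP; apply: measurable_funM.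
have hi k : (\int[mu]_x h k x <= (1 / (2 ^ k.+1)%:R)%:E)%E.
  rewrite /h; under eq_integral do rewrite EFinM.
  rewrite ge0_integralZl_EFin//; last 2 first.
  - by move=> x _; rewrite lee_fin sqr_ge0.
  - exact/measurable_EFinP.
  apply: le_trans (lee_wpmul2l _ (vk k)) _; first by rewrite lee_fin exprn_ge0.
  by rewrite -EFinM lee_fin (mulrA (4 ^+ k)) exprVn divff ?mul1r.
(* The factor [4 ^+ k] in [h] cancels the one in the hypothesis and leaves the bounds 1/2^(k+1),
   whose sum is 1. *)
have hs : (\int[mu]_x (\sum_(k <oo) h k x) < +oo)%E.
  rewrite integral_nneseries//; apply: (@le_lt_trans _ _ 1%E); last exact: ltry.
  have := @cvg_geometric_eseries_half R 1 0; rewrite expr0 divr1 => /cvg_lim <-//.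
  rewrite /eseries; apply: lee_nneseries => [k _ _|k _].
    exact: integral_ge0.
  by rewrite addn1; exact: hi.
have ih : mu.-integrable setT (fun x => \sum_(k <oo) h k x)%E.
  apply/integrableP; split; first exact: ge0_emeasurable_sum.
  under eq_integral do rewrite gee0_abs ?nneseries_ge0//.
  exact: hs.
apply: filterS (integrable_ae measurableT ih) => x /(_ I) hx.
pose M := fine (\sum_(k <oo) h k x)%E.
have M0 : 0 <= M by rewrite fine_ge0// nneseries_ge0.
have hM k : 4 ^+ k * (v k.+1 x - v k x) ^+ 2 <= M.
  rewrite -lee_fin /M fineK//.
  apply: le_trans (nneseries_lim_ge k.+1 (fun n _ _ => h0 n x)).
  by rewrite big_nat_recr//= leeDr// sume_ge0.
apply: (@telescope_geometric_cvg _ (Num.sqrt M)); first exact: sqrtr_ge0.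
move=> k; rewrite -(@ler_pXn2r _ 2)// ?nnegrE ?mulr_ge0 ?sqrtr_ge0 ?exprn_ge0//.
rewrite real_normK ?num_real// exprMn sqr_sqrtr// -exprM mulnC exprM.
rewrite (_ : 2^-1 ^+ 2 = 4^-1 :> R); last by rewrite exprVn -natrX.
by rewrite exprVn ler_pdivlMr ?exprn_gt0// mulrC.
Qed.

(** A rapidly converging subsequence has an almost everywhere limit, and Fatou's lemma turns the
    Cauchy bound into a bound on the distance of the whole sequence to that limit. *)
Lemma Lfun2_complete (u : nat -> T -> R) : (forall n, u n \in Lfun mu 2%:E) ->
  (forall e : R, 0 < e -> exists N, forall m n, (N <= m)%N -> (N <= n)%N ->
     (\int[mu]_x ((u m x - u n x) ^+ 2)%:E <= e%:E)%E) ->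
  exists2 f, f \in Lfun mu 2%:E &
    forall e : R, 0 < e -> exists N, forall n, (N <= n)%N ->
     (\int[mu]_x ((u n x - f x) ^+ 2)%:E <= e%:E)%E.
Proof.
move=> uL uC.
have mU n : measurable_fun setT (u n) by exact: Lfun_measurable (uL n).
pose ek k : R := 4^-1 ^+ k * (1 / (2 ^ k.+1)%:R).
have ek0 k : 0 < ek k.
  by rewrite mulr_gt0 ?exprn_gt0// divr_gt0// ltr0n expn_gt0.
pose N k := sval (cid (uC _ (ek0 k))).
(* Summing makes [nk] nondecreasing and at least [N k]; the successors force [k <= nk k], so that
   late terms of [v] are late terms of [u]. *)
pose nk k := (\sum_(i < k.+1) (N i).+1)%N.
have nkN k : (N k <= nk k)%N.
  by rewrite /nk big_ord_recr /=; apply: leq_trans (leq_addl _ _); exact: leqnSn.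
have nkS k : (nk k <= nk k.+1)%N by rewrite /nk [leqRHS]big_ord_recr /= leq_addr.
have nkk k : (k <= nk k)%N.
  elim: k => [//|k IH]; rewrite /nk big_ord_recr /= addnS ltnS.
  exact: leq_trans IH (leq_addr _ _).
pose v k := u (nk k).
have vk k : (\int[mu]_x ((v k.+1 x - v k x) ^+ 2)%:E <= (ek k)%:E)%E.
  rewrite /v /N; apply: (svalP (cid (uC _ (ek0 k)))); last exact: nkN.
  exact: leq_trans (nkN k) (nkS k).
have cv := ae_cvg_rapid (fun n => mU _) vk.
(* The upper limit is measurable and defined everywhere; it is the limit wherever [v] converges. *)
pose f x := fine (limn_esup (fun k => (v k x)%:E)).
have mf : measurable_fun setT f.
  apply: measurableT_comp => //.
  by apply: measurable_fun_limn_esup => k; apply/measurable_EFinP; exact: mU.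
have vf : {ae mu, forall x, v ^~ x @ \oo --> f x}.
  apply: filterS cv => x /cvg_ex[/= l vl].
  suff -> : f x = l by [].
  have vlE : (fun k => (v k x)%:E) @ \oo --> l%:E by apply: cvg_EFin => //; exact: nearW.
  by rewrite /f (cvg_limn_einf_sup vlE).2.
have uf e : 0 < e -> exists N, forall n, (N <= n)%N ->
     (\int[mu]_x ((u n x - f x) ^+ 2)%:E <= e%:E)%E.
  move=> e0; have [N0 N0e] := uC e e0; exists N0 => n N0n.
  pose g k x := ((u n x - v k x) ^+ 2)%:E.
  have mg k : measurable_fun setT (g k).
    apply/measurable_EFinP; apply: measurable_funX.
    by apply: measurable_funB => //; exact: mU.
  have g0 k x : setT x -> (0 <= g k x)%E by rewrite lee_fin sqr_ge0.
  (* Almost everywhere the integrand is the limit, hence the lower limit, of the [g k]; Fatou's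
     lemma then applies. *)
  apply: (@le_trans _ _ (\int[mu]_x limn_einf (g ^~ x))%E).
    apply: ae_ge0_le_integral => //.
    - by move=> x _; rewrite lee_fin sqr_ge0.
    - by apply/measurable_EFinP; apply: measurable_funX; exact: measurable_funB.
    - move=> x _; rewrite limn_einf_lim; apply: lime_ge; first exact: is_cvg_einfs.
      apply: nearW => k; apply: le_ereal_inf_tmp => _ [m _ <-]; exact: g0.
    - rewrite (_ : (fun x => _) = (fun x => - limn_esup (fun k => - g k x)))%E; last first.
        by apply/funext => x; rewrite /limn_einf.
      apply: measurableT_comp => //; apply: measurable_fun_limn_esup => k.
      exact: measurableT_comp.
    - apply: filterS vf => x vx _.
      suff gx : g ^~ x @ \oo --> ((u n x - f x) ^+ 2)%:E.
        by rewrite (cvg_limn_einf_sup gx).1.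
      apply: cvg_EFin; first exact: nearW.
      have uvf : u n x - v k x @[k --> \oo] --> u n x - f x.
        by apply: cvgB => //; exact: cvg_cst.
      exact: (cvgM uvf uvf).
  apply: le_trans (fatou mu measurableT mg g0) _.
  rewrite limn_einf_lim; apply: lime_le; first exact: is_cvg_einfs.
  (* The infimum over the indices from [k] on is at most the entry at [maxn k N0], where the Cauchy
     bound holds. *)
  near=> k; apply: ge_ereal_inf; exists (\int[mu]_x g (maxn k N0) x)%E.
    by exists (maxn k N0) => //=; exact: leq_maxl.
  by apply: N0e => //; apply: leq_trans (leq_maxr k _) (nkk _).
exists f; last exact: uf.
have [N0 N0f] := uf 1 ltr01.
have df : (fun x => u N0 x - f x) \in Lfun mu 2%:E.
  apply: integrable_sqr_Lfun2; first exact: measurable_funB.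
  exact: le_lt_trans (N0f _ (leqnn _)) (ltry _).
have -> : f = u N0 - (fun x => u N0 x - f x).
  by apply/funext => x; rewrite !fctE opprB addrC subrK.
have L21 : (1 <= 2%:E :> \bar R)%E by rewrite lee_fin ler1n.
have [_ LD] := Lfun_addr_closed mu L21.
exact: LD (uL N0) (Lfun_oppr_closed df).
Unshelve. all: by end_near. Qed.

End RealL2.

(** * Independence and orthonormality *)

Section BernoulliNoise.
Context d (T : measurableType d) (R : realType) (P : probability T R).
Variables (Z : nat -> {RV P >-> R}) (p : nat -> R).
Hypothesis p01 : forall n, 0 < p n < 1.
Hypothesis Ztheta : forall n,
  P [set x | Z n x = Bernoulli_theta p n] = (p n)%:E.
Hypothesis ZNtheta : forall n,
  P [set x | Z n x = - (Bernoulli_theta p n)^-1] = (1 - p n)%:E.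
Hypothesis Zindep : independent_seq Z.

Let th := Bernoulli_theta p.
Let A n : set T := Z n @^-1` [set th n].
Let A' n : set T := Z n @^-1` [set - (th n)^-1].

Lemma Bernoulli_theta_gt0 n : 0 < th n.
Proof.
by have /andP[? ?] := p01 n; rewrite sqrtr_gt0 divr_gt0// subr_gt0.
Qed.

Lemma measurable_preimage_RV n (B : set R) : measurable B ->
  measurable (Z n @^-1` B).
Proof. by move=> mB; rewrite -[_ @^-1` _]setTI; exact: measurable_funPT. Qed.

Let mA n : measurable (A n).
Proof. exact: measurable_preimage_RV. Qed.

Let mA' n : measurable (A' n).
Proof. exact: measurable_preimage_RV. Qed.

Let thN n : th n != - (th n)^-1.
Proof.
rewrite gt_eqF//; apply: (@lt_trans _ _ 0); last exact: Bernoulli_theta_gt0.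
by rewrite oppr_lt0 invr_gt0 Bernoulli_theta_gt0.
Qed.

(** The two level sets are disjoint and their probabilities add up to 1; the countably many
    exceptional null sets are then united. *)
Lemma Bernoulli_two_values :
  {ae P, forall x, forall n, Z n x = th n \/ Z n x = - (th n)^-1}.
Proof.
apply: ae_foralln => n.
exists (~` (A n `|` A' n)); split; first by apply: measurableC; exact: measurableU.
  transitivity (1 - P (A n `|` A' n))%E.
    by apply: probability_setC; exact: measurableU.
  have -> : P (A n `|` A' n) = (P (A n) + P (A' n))%E.
    apply: measureU => //; apply/seteqP; split => x // -[].
    by rewrite /A /A' /= => -> tt; have := thN n; rewrite -tt eqxx.
  rewrite (Ztheta n : P (A n) = _) (ZNtheta n : P (A' n) = _).
  by rewrite (_ : (p n)%:E + (1 - p n)%:E = 1)%E ?subee// -EFinD subrKC.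
by move=> x /= h Ax; apply: h; case: Ax => /=; [left|right].
Qed.

Definition cylinder (s : {fset nat}) (B : nat -> set R) : set T :=
  \bigcap_(i in [set` s]) (Z i @^-1` B i).

Lemma cylinder0 B : cylinder fset0 B = setT.
Proof. by apply/seteqP; split => x // _ i /=; rewrite inE. Qed.

Lemma cylinderU1 i s B : cylinder (i |` s)%fset B = Z i @^-1` B i `&` cylinder s B.
Proof.
apply/seteqP; split => x /=.
  move=> h; split; first by apply: h => /=; rewrite !inE eqxx.
  by move=> j /= js; apply: h => /=; rewrite !inE js orbT.
by move=> [Bi h] j /=; rewrite !inE => /predU1P[->//|]; exact: h.
Qed.

Lemma measurable_cylinder s B : (forall i, measurable (B i)) ->
  measurable (cylinder s B).
Proof.
by move=> mB; apply: fin_bigcap_measurable => // i _; exact: measurable_preimage_RV.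
Qed.

(* Agrees almost surely with the composite of Z n and a function taking the
   value a n at th n and b n at - 1 / th n, but is bounded everywhere. *)
Let W (a b : nat -> R) n x : R := a n * \1_(A n) x + b n * \1_(A' n) x.

Let WE a b n x (f : R -> R) : a n = f (th n) -> b n = f (- (th n)^-1) ->
  Z n x = th n \/ Z n x = - (th n)^-1 -> W a b n x = f (Z n x).
Proof.
move=> an bn Zn; rewrite /W !indicE.
case: Zn => Zn.
  rewrite mem_set ?memNset /A' /A /= ?Zn ?mulr1 ?mulr0 ?addr0//.
  exact/eqP/thN.
rewrite memNset ?mem_set /A' /A /= ?Zn ?mulr1 ?mulr0 ?add0r//.
by apply/eqP; rewrite eq_sym thN.
Qed.

Let W_bounded (s : seq nat) a b : exists M, forall x, `|\prod_(i <- s) W a b i x| <= M.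
Proof.
elim: s => [|n s [M sM]].
  by exists 1 => x; rewrite big_nil normr1.
exists ((`|a n| + `|b n|) * M) => x; rewrite big_cons normrM ler_pM//.
apply: le_trans (ler_normD _ _) _; rewrite !normrM !indicE.
by apply: lerD; rewrite ler_piMr//; case: (_ \in _); rewrite ?normr1 ?normr0.
Qed.

Let mW (s : seq nat) a b : measurable_fun setT (fun x => \prod_(i <- s) W a b i x).
Proof.
apply: measurable_prod => i _; apply: measurable_funD; apply: measurable_funM => //.
Qed.

Let W_integrable (s : seq nat) a b (C : set T) : measurable C ->
  P.-integrable C (EFin \o (fun x => \prod_(i <- s) W a b i x)).
Proof.
move=> mC; have [M sM] := W_bounded s a b.
apply: (@integrableS _ _ _ P setT) => //.
apply: measurable_bounded_integrable => //.
  exact: le_lt_trans (probability_le1 P measurableT) (ltry 1).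
exists M; split; first exact: num_real.
by move=> y My x _; apply: le_trans (sM x) (ltW My).
Qed.

(** Induction on [s]. Expanding the factor at [i] splits the integral into two, over the cylinders
    where [Z i] is moreover fixed to one of its two values. The cylinder is a parameter so as to
    collect these constraints, and independence is used only once [s] is exhausted. *)
Let cylinder_W_integral (s : seq nat) (t : {fset nat}) (a b : nat -> R)
    (B : nat -> set R) : (forall i, measurable (B i)) ->
  uniq s -> {in s, forall i, i \notin t} ->
  \int[P]_(x in cylinder t B) (\prod_(i <- s) W a b i x) =
  (\prod_(i <- t) fine (P (Z i @^-1` B i))) *
  \prod_(i <- s) (p i * a i + (1 - p i) * b i).
Proof.
elim: s t B => [|i s IH] t B mB.
  move=> _ _; under eq_Rintegral do rewrite big_nil.
  rewrite Rintegral_cst; last exact: measurable_cylinder.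
  rewrite mul1r big_nil mulr1.
  transitivity (fine (\prod_(i <- t) P (Z i @^-1` B i))%E).
    by congr fine; exact: Zindep.
  have -> : (\prod_(i <- t) P (Z i @^-1` B i))%E =
      (\prod_(i <- t) fine (P (Z i @^-1` B i)))%:E; last by [].
  elim/big_rec2 : _ => // j x y _ ->; rewrite EFinM fineK//.
  by apply: fin_num_measure; exact: measurable_preimage_RV.
move=> /= /andP[iNs us] st.
have iNt : i \notin t by apply: st; rewrite mem_head.
have st' : {in s, forall j, j \notin (i |` t)%fset}.
  move=> j js; rewrite !inE negb_or st ?inE ?js ?orbT// andbT.
  by apply: contraNneq iNs => <-.
have jNi j : j \in t -> (j == i) = false.
  by move=> jt; apply: contraNF iNt => /eqP <-.
pose B' c j := if j == i then [set c] else B j.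
have mB' c j : measurable (B' c j) by rewrite /B'; case: ifP.
have cB' c : cylinder (i |` t)%fset (B' c) = cylinder t B `&` Z i @^-1` [set c].
  rewrite cylinderU1 setIC /B' eqxx; congr (_ `&` _).
  by apply: eq_bigcapr => j /= jt; rewrite jNi.
have pB' c : \prod_(j <- (i |` t)%fset) fine (P (Z j @^-1` B' c j)) =
    fine (P (Z i @^-1` [set c])) * \prod_(j <- t) fine (P (Z j @^-1` B j)).
  rewrite big_fsetU1//= /B' eqxx; congr (_ * _).
  by apply: eq_big_seq => j jt; rewrite jNi.
have mC := measurable_cylinder t mB.
set F := fun x => \prod_(j <- s) W a b j x.
have intF D : measurable D -> P.-integrable D (EFin \o F) by exact: W_integrable.
have mul_indic c E x : F x * (c * \1_E x) = c * (F \_ E) x :> R.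
  by rewrite patchE indicE; case: (x \in E); rewrite ?mulr1 ?mulr0 ?mulr1// mulrC.
have intFE E : measurable E -> P.-integrable (cylinder t B) (EFin \o (F \_ E)).
  move=> mE; rewrite -restrict_EFin; apply/integrable_restrict => //.
  by apply: intF; exact: measurableI.
rewrite (@eq_Rintegral _ _ _ _ _
  (fun x => a i * (F \_ (A i)) x + b i * (F \_ (A' i)) x)); last first.
  by move=> x _; rewrite big_cons mulrC /W mulrDr !mul_indic.
rewrite RintegralD//; last 2 first.
  exact: (integrableZl mC (a i) (intFE _ (mA i))).
  exact: (integrableZl mC (b i) (intFE _ (mA' i))).
rewrite !RintegralZl//; last 2 first.
  exact: intFE.
  exact: intFE.
rewrite -!Rintegral_mkcondr /A /A' -!cB' !IH// !pB'.
have -> : fine (P (Z i @^-1` [set th i])) = p i.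
  by rewrite -[RHS]/(fine (p i)%:E); congr fine; exact: Ztheta.
have -> : fine (P (Z i @^-1` [set - (th i)^-1])) = 1 - p i.
  by rewrite -[RHS]/(fine (1 - p i)%:E); congr fine; exact: ZNtheta.
rewrite big_cons; ring.
Qed.

(** The integrand is a product over the union [u] of functions of single variables, so the integral
    factorizes. An index in both sets contributes E[Z_i^2] = 1, an index in exactly one contributes
    E[Z_i] = 0. *)
Lemma Zprod_inner (s t : {fset nat}) :
  fine 'E_P[(fun x => (\prod_(i <- s) Z i x) * (\prod_(i <- t) Z i x))] =
  (s == t)%:R.
Proof.
pose f i (z : R) := (if i \in s then z else 1) * (if i \in t then z else 1).
pose a i := f i (th i); pose b i := f i (- (th i)^-1).
pose u := (s `|` t)%fset.
have prodE x : (\prod_(i <- s) Z i x) * (\prod_(i <- t) Z i x) =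
    \prod_(i <- u) f i (Z i x).
  rewrite big_split /=; congr (_ * _).
    rewrite -(@big_fset_incl _ _ _ _ s u) ?fsubsetUl//; last first.
      by move=> i _ /negbTE ->.
    by apply: eq_big_seq => i ->.
  rewrite -(@big_fset_incl _ _ _ _ t u) ?fsubsetUr//; last first.
    by move=> i _ /negbTE ->.
  by apply: eq_big_seq => i ->.
have ae_eqW : {ae P, forall x, \prod_(i <- u) f i (Z i x) = \prod_(i <- u) W a b i x}.
  apply: filterS Bernoulli_two_values => x Zx.
  by apply: eq_bigr => i _; rewrite (@WE a b i x (f i)).
have mZ (r : {fset nat}) : measurable_fun setT (fun x => \prod_(i <- r) Z i x).
  exact: measurable_prod.
transitivity (\int[P]_(x in cylinder fset0 (fun=> setT)) (\prod_(i <- u) W a b i x)).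
  rewrite cylinder0 unlock /Rintegral; congr fine; apply: ae_eq_integral => //.
  - by apply/measurable_EFinP; apply: measurable_funM.
  - exact/measurable_EFinP.
  - by apply: filterS ae_eqW => x xE _; rewrite -xE -prodE.
rewrite cylinder_W_integral ?fset_uniq//.
rewrite big_seq_fset0 mul1r.
have m_i i : i \in u -> p i * a i + (1 - p i) * b i = ((i \in s) == (i \in t))%:R.
  have /andP[p0 p1] := p01 i; have q0 : 0 < 1 - p i by rewrite subr_gt0.
  have th0 : th i != 0 by rewrite gt_eqF// Bernoulli_theta_gt0.
  have th2 : th i ^+ 2 * p i = 1 - p i.
    by rewrite sqr_sqrtr ?divr_ge0 ?ltW// mulfVK// gt_eqF.
  rewrite /u !inE /a /b /f; case: (i \in s); case: (i \in t) => //= _;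
    rewrite ?mulr1 ?mul1r ?mulrNN.
  - rewrite (_ : (1 - p i) * _ = p i); last by rewrite -th2; field.
    by rewrite -expr2 mulrC th2 subrK.
  (* Multiplying by [th i] clears the inverse, and the mean vanishes by [th2]. *)
  - apply: (mulIf th0); rewrite mul0r mulrDl -!mulrA mulNr mulVf// mulrN1.
    by rewrite -expr2 mulrC th2 subrr.
  - apply: (mulIf th0); rewrite mul0r mulrDl -!mulrA mulNr mulVf// mulrN1.
    by rewrite -expr2 mulrC th2 subrr.
rewrite (eq_big_seq (fun i => ((i \in s) == (i \in t))%:R)); last by move=> i /m_i.
have [->|st] := eqVneq s t.
  by rewrite big1_seq// => i _; rewrite eqxx.
have [i iu ist] : exists2 i, i \in u & (i \in s) != (i \in t).
  apply: contrapT => h; move/eqP: st; apply; apply/fsetP => i.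
  apply/eqP; apply: contrapT => /negP ist; apply: h; exists i => //.
  by rewrite /u !inE; move: ist; case: (i \in s); case: (i \in t).
by rewrite (big_fsetD1 i)//= (negbTE ist) mul0r.
Qed.

End BernoulliNoise.

(** * Totality *)

Section BernoulliTotal.
Context d (T : measurableType d) (R : realType) (P : probability T R).
Variables (Z : nat -> {RV P >-> R}) (p : nat -> R).
Hypothesis p01 : forall n, 0 < p n < 1.
Hypothesis Ztheta : forall n,
  P [set x | Z n x = Bernoulli_theta p n] = (p n)%:E.
Hypothesis ZNtheta : forall n,
  P [set x | Z n x = - (Bernoulli_theta p n)^-1] = (1 - p n)%:E.
Hypothesis Zgen : @measurable d T = sigma_of_seq Z.

Let Zp (s : {fset nat}) x : R := \prod_(i <- s) Z i x.

Lemma Zprod_Lfun2 s : Zp s \in Lfun P 2%:E.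
Proof. by have /L2predP[] := Zprod_L2 p01 Ztheta ZNtheta s. Qed.

Variable u : T -> R.
Hypothesis uL : u \in Lfun P 2%:E.
Hypothesis uZ : forall s, \int[P]_x (u x * Zp s x) = 0.

Let uZ_integrable s D : measurable D ->
  P.-integrable D (EFin \o (fun x => u x * Zp s x)).
Proof.
move=> mD; apply: (@integrableS _ _ _ P setT) => //.
by apply/Lfun1_integrable; exact: Lfun2_mul_Lfun1 uL (Zprod_Lfun2 s).
Qed.

(* On the two values of Z_i the indicator of B i is an affine function
   alpha + beta z, which trades the constraint on Z_i for a factor Z_i. *)
Let cylinder_integral0 (s t : {fset nat}) (B : nat -> set R) :
  (forall i, measurable (B i)) -> [disjoint s & t]%fset ->
  \int[P]_(x in cylinder Z s B) (u x * Zp t x) = 0.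
Proof.
move=> mB; move: s t.
(* The induction is on [s] for all [t] at once, since an index removed from [s] may move to [t]. *)
apply: finSet_rect => s IH t st.
have [->|[i is_]] := fset_0Vmem s; first by rewrite cylinder0 uZ.
pose s' := (s `\ i)%fset.
have s's : (s' `<` s)%fset by rewrite fproperD1.
have iNt : i \notin t by move/fdisjointP: st; apply.
have IHt : \int[P]_(x in cylinder Z s' B) (u x * Zp t x) = 0.
  by apply: IH => //; exact: fdisjointWl (fsubsetDl _ _) st.
have IHit : \int[P]_(x in cylinder Z s' B) (u x * Zp (i |` t)%fset x) = 0.
  apply: IH => //; rewrite fdisjointXU fdisjointX1 !inE eqxx/=.
  exact: fdisjointWl (fsubsetDl _ _) st.
have mC : measurable (cylinder Z s' B) by exact: measurable_cylinder.
have mE : measurable (Z i @^-1` B i) by exact: measurable_preimage_RV.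
set h := Bernoulli_theta p i.
have h0 : 0 < h by exact: Bernoulli_theta_gt0.
pose k := - h^-1.
have hk : h - k != 0.
  by rewrite gt_eqF// /k opprK addr_gt0// invr_gt0.
pose chi z : R := \1_(B i) z.
pose beta := (chi h - chi k) / (h - k).
pose alpha := chi h - beta * h.
have chiE z : z = h \/ z = k -> chi z = alpha + beta * z.
  by case=> ->; rewrite /alpha /beta; field.
have -> : cylinder Z s B = cylinder Z s' B `&` Z i @^-1` B i.
  by rewrite setIC -cylinderU1 fsetD1K.
rewrite Rintegral_mkcondr.
transitivity (\int[P]_(x in cylinder Z s' B)
    (alpha * (u x * Zp t x) + beta * (u x * Zp (i |` t)%fset x))).
  have mr s0 := measurable_int P (uZ_integrable s0 mC).
  rewrite /Rintegral; congr fine; apply: ae_eq_integral => //.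
  - have /(integrable_restrict _ mE mC)/measurable_int :=
      uZ_integrable t (measurableI _ _ mC mE).
    by rewrite restrict_EFin.
  - apply/measurable_EFinP; apply: measurable_funD; apply: measurable_funM => //;
      apply/measurable_EFinP; exact: mr.
  apply: filterS (Bernoulli_two_values p01 Ztheta ZNtheta) => x /(_ i) Zx _.
  congr EFin; rewrite patchE.
  have -> : Zp (i |` t)%fset x = Z i x * Zp t x by rewrite /Zp big_fsetU1.
  transitivity (chi (Z i x) * (u x * Zp t x)).
    rewrite /chi indicE; have -> : (x \in Z i @^-1` B i) = (Z i x \in B i).
      by apply/idP/idP; rewrite !inE.
    by case: (_ \in _); rewrite ?mul1r ?mul0r.
  by rewrite chiE//; ring.
rewrite RintegralD//; last 2 first.
  exact: (integrableZl mC alpha (uZ_integrable t mC)).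
  exact: (integrableZl mC beta (uZ_integrable _ mC)).
rewrite !RintegralZl//; try exact: uZ_integrable.
by rewrite IHt IHit !mulr0 addr0.
Qed.

Let G : set (set T) :=
  [set E | exists s B, (forall i, measurable (B i)) /\ E = cylinder Z s B].

Let setI_closed_G : setI_closed G.
Proof.
move=> _ _ [s [B [mB ->]]] [t [B' [mB' ->]]].
(* An index outside one of the two supports is unconstrained there, hence [setT]. *)
pose C i : set R := (if i \in s then B i else setT) `&` (if i \in t then B' i else setT).
exists (s `|` t)%fset, C; split.
  by move=> i; apply: measurableI; case: ifP.
apply/seteqP; split => x.
  move=> [Bx B'x] i _; split; case: ifP => // it; [exact: Bx|exact: B'x].
move=> Cx; split => i /= it.
  have := Cx i; rewrite /C /preimage /= inE it /= => -[]//.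
have := Cx i; rewrite /C /preimage /= inE it /= orbT => -[]//.
Qed.

Let u_integrable D : measurable D -> P.-integrable D (EFin \o u).
Proof.
move=> mD; apply: (@integrableS _ _ _ P setT) => //.
have := uZ_integrable fset0 measurableT; congr (P.-integrable _ _).
by apply/funext => x /=; rewrite /Zp big_seq_fset0 mulr1.
Qed.

Let H : set (set T) :=
  [set E | measurable E /\ (\int[P]_(x in E) (u x)%:E)%E = 0%E].

Let fin_int D : measurable D -> (\int[P]_(x in D) (u x)%:E)%E \is a fin_num.
Proof. by move=> mD; exact: integrable_fin_num (u_integrable mD). Qed.

Let GH : G `<=` H.
Proof.
move=> _ [s [B [mB ->]]]; split; first exact: measurable_cylinder.
have := @cylinder_integral0 s fset0 B mB (fdisjointX0 _).
rewrite /Rintegral; under eq_integral => x _ do rewrite /Zp big_seq_fset0 mulr1.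
move=> /eqP; rewrite fine_eq0; first by move/eqP.
by apply: fin_int; exact: measurable_cylinder.
Qed.

Let H_dynkin : dynkin H.
Proof.
have HT : H setT by apply: GH; exists fset0, (fun=> setT); rewrite cylinder0.
split => //.
- move=> E [mE E0]; split; first exact: measurableC.
  have := HT.2; rewrite -(setvU E) integral_setU//; last 3 first.
  + exact: measurableC.
  + by rewrite setvU; exact: measurable_int (u_integrable measurableT).
  + by apply/disj_setPS; rewrite setICl.
  by rewrite E0 adde0.
- move=> F tF HF; have mF k : measurable (F k) by have [] := HF k.
  split; first exact: bigcupT_measurable.
  rewrite integral_bigcup//; last by apply: u_integrable; exact: bigcupT_measurable.
  by apply: eseries0 => k _ _; have [] := HF k.
Qed.

(** The events over which [u] integrates to 0 form a Dynkin system containing the cylinders, a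
    pi-system that generates the sigma-algebra. So [u] integrates to 0 over every event and vanishes
    almost surely. *)
Lemma Zprod_total : u = cst 0 %[ae P].
Proof.
have mH E : measurable E -> H E.
  rewrite Zgen => mE.
  apply: (@lambda_system_subset T G setI_closed_G setT H) => //.
    exact/dynkin_lambda_system.
  apply: (@sub_smallest2r _ _ _ _ _ _ E) mE; first exact: smallest_sigma_algebra.
  move=> _ [n _ [B mB <-]]; exists [fset n]%fset, (fun=> B); split => //.
  apply/seteqP; split => x /=.
    by move=> [_ Bx] i /=; rewrite inE => /eqP ->.
  by move=> h; split => //; apply: (h n); rewrite /= inE.
have : ae_eq P setT (EFin \o u) (cst 0%E).
  apply: integral_ae_eq => //; first exact: u_integrable.
  by move=> E _ mE; rewrite integral_cst// mul0e; exact: (mH E mE).2.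
by apply: filterS => x /= /(_ I) [].
Qed.

End BernoulliTotal.

(** * The Hilbert space of complex classes *)

Section L2Hilbert.
Context d (T : measurableType d) (R : realType) (P : probability T R).
Implicit Types x y z : L2 P.

Lemma L2inner0r x : L2inner x 0 = 0.
Proof. by have := L2innerDZr (-1) x x x; rewrite scaleN1r addNr mulN1r addNr. Qed.

Lemma L2innerDr x y z : L2inner x (y + z) = L2inner x y + L2inner x z.
Proof. by rewrite -[y]scale1r L2innerDZr mul1r scale1r. Qed.

Lemma L2innerZr a x y : L2inner x (a *: y) = a * L2inner x y.
Proof. by rewrite -[a *: y]addr0 L2innerDZr L2inner0r addr0. Qed.

Lemma L2innerNr x y : L2inner x (- y) = - L2inner x y.
Proof. by rewrite -scaleN1r L2innerZr mulN1r. Qed.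

Lemma L2innerBr x y z : L2inner x (y - z) = L2inner x y - L2inner x z.
Proof. by rewrite L2innerDr L2innerNr. Qed.

Lemma L2innerDl x y z : L2inner (x + y) z = L2inner x z + L2inner y z.
Proof.
by rewrite (L2innerC z (x + y)) (L2innerC z x) (L2innerC z y) L2innerDr rmorphD.
Qed.

Lemma L2innerNl x y : L2inner (- x) y = - L2inner x y.
Proof. by rewrite (L2innerC y (- x)) (L2innerC y x) L2innerNr rmorphN. Qed.

Lemma L2inner_sumr (I : Type) (r : seq I) x (f : I -> L2 P) :
  L2inner x (\sum_(i <- r) f i) = \sum_(i <- r) L2inner x (f i).
Proof.
elim: r => [|i r IH]; first by rewrite !big_nil L2inner0r.
by rewrite !big_cons L2innerDr IH.
Qed.

(** The norm of the module takes values in [R[i]]; this squared real version makes real inequalities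
    available and avoids square roots. *)
Definition norm2 x : R := complex.Re (L2inner x x).

Lemma norm2_ge0 x : 0 <= norm2 x. Proof. exact: L2inner_ge0. Qed.

Lemma norm2N x : norm2 (- x) = norm2 x.
Proof. by rewrite /norm2 L2innerNl L2innerNr opprK. Qed.

Lemma norm2D x y : norm2 (x + y) = norm2 x + 2 * complex.Re (L2inner x y) + norm2 y.
Proof.
rewrite /norm2 L2innerDl !L2innerDr (L2innerC x y).
by case: (L2inner x x) (L2inner y y) (L2inner x y) => [a b] [a' b'] [c c'] /=; ring.
Qed.

Lemma norm2B x y : norm2 (x - y) = norm2 x - 2 * complex.Re (L2inner x y) + norm2 y.
Proof. by rewrite norm2D norm2N L2innerNr raddfN /= mulrN. Qed.

Lemma norm2BC x y : norm2 (x - y) = norm2 (y - x).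
Proof. by rewrite -norm2N opprB. Qed.

Lemma norm2D_le x y : norm2 (x + y) <= 2 * norm2 x + 2 * norm2 y.
Proof. by have := norm2_ge0 (x - y); rewrite norm2B norm2D; lra. Qed.

Lemma norm2_class (f : L2fun P) : (norm2 (L2class f))%:E =
  (\int[P]_x ((complex.Re (f x)) ^+ 2)%:E + \int[P]_x ((complex.Im (f x)) ^+ 2)%:E)%E.
Proof.
have [/Lfun2_integrable_sqr rL /Lfun2_integrable_sqr iL] := L2predP _ _ (L2funP f).
rewrite -integralD//= /norm2 L2inner_class /L2funinner /Cexpectation /= unlock.
rewrite -[RHS]fineK; last by apply: integrable_fin_num => //; exact: integrableD.
congr EFin; congr fine; apply: eq_integral => x _; congr EFin.
by rewrite /=; case: (f x) => a b /=; ring.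
Qed.

(** By [norm2_class] the real and imaginary parts of representatives are Cauchy separately, and
    their limits are reassembled. *)
Lemma L2_complete (u : nat -> L2 P) :
  (forall e : R, 0 < e -> exists N, forall m n, (N <= m)%N -> (N <= n)%N ->
     norm2 (u m - u n) <= e) ->
  exists y, forall e : R, 0 < e -> exists N, forall n, (N <= n)%N ->
     norm2 (u n - y) <= e.
Proof.
move=> uC; pose f n := L2repr (u n).
have fE n : L2class (f n) = u n by exact: L2reprK.
have fB m n : L2class (f m - f n) = u m - u n by rewrite /L2class raddfB /= -!/(L2class _) !fE.
have fL n := L2predP _ _ (L2funP (f n)).
have sq0 (h : T -> R) : (0 <= \int[P]_x ((h x) ^+ 2)%:E)%E.
  by apply: integral_ge0 => x _; rewrite lee_fin sqr_ge0.
have [|r rL ur] := @Lfun2_complete _ _ _ P (fun n t => complex.Re (f n t)) (fun n => (fL n).1).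
  move=> e /uC[N uN]; exists N => m n mN nN; have := uN _ _ mN nN.
  rewrite -lee_fin -fB norm2_class; apply: le_trans.
  rewrite (eq_integral (fun t => ((complex.Re ((f m - f n) t)) ^+ 2)%:E)) ?leeDl//.
  by move=> t _; congr ((_ ^+ 2)%:E); rewrite -raddfB.
have [|i iL ui] := @Lfun2_complete _ _ _ P (fun n t => complex.Im (f n t)) (fun n => (fL n).2).
  move=> e /uC[N uN]; exists N => m n mN nN; have := uN _ _ mN nN.
  rewrite -lee_fin -fB norm2_class; apply: le_trans.
  rewrite (eq_integral (fun t => ((complex.Im ((f m - f n) t)) ^+ 2)%:E)) ?leeDr//.
  by move=> t _; congr ((_ ^+ 2)%:E); rewrite -raddfB.
have gL : (fun t => r t +i* i t) \in L2pred P by apply/L2predP.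
exists (L2class (MkL2fun gL)) => e e0.
have e20 : 0 < e / 2 by rewrite divr_gt0.
have [[N1 urN] [N2 uiN]] := (ur _ e20, ui _ e20).
exists (maxn N1 N2) => n; rewrite geq_max => /andP[n1 n2].
rewrite -fE (_ : _ - _ = L2class (f n - MkL2fun gL)); last by rewrite /L2class raddfB.
rewrite -lee_fin norm2_class [e in leRHS]splitr EFinD; apply: leeD.
  rewrite (eq_integral (fun t => ((complex.Re (f n t) - r t) ^+ 2)%:E)); first exact: urN.
  move=> t _; congr ((_ ^+ 2)%:E).
  exact: (raddfB (@complex.Re R) (f n t) (r t +i* i t)).
rewrite (eq_integral (fun t => ((complex.Im (f n t) - i t) ^+ 2)%:E)); first exact: uiN.
move=> t _; congr ((_ ^+ 2)%:E).
exact: (raddfB (@complex.Im R) (f n t) (r t +i* i t)).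
Qed.

Lemma cvg_norm2P (I : Type) (F : set_system I) {FF : Filter F} (u : I -> L2 P) y :
  u @ F --> y <-> forall e : R, 0 < e -> \forall n \near F, norm2 (y - u n) <= e.
Proof.
have normE x (e : R) : 0 <= e -> (`|x| <= e%:C) = (norm2 x <= e ^+ 2).
  move=> e0; rewrite -[ `|x| ]/(L2norm x) /L2norm lecR.
  by rewrite -(@ler_pXn2r _ 2)// ?nnegrE ?sqrtr_ge0// sqr_sqrtr ?L2inner_ge0.
split=> [/cvgrPdist_le uy e e0|uy].
  have s0 : 0 < Num.sqrt e by rewrite sqrtr_gt0.
  have := uy (Num.sqrt e)%:C; rewrite ltcR => /(_ s0); apply: filterS => n.
  by rewrite normE ?sqr_sqrtr// ltW.
apply/cvgrPdist_le => -[e e'] e0.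
(* Positivity in [R[i]] forces the imaginary part to vanish, so only real radii occur. *)
have : e' = 0 /\ 0 < e by move: e0; rewrite ltcE /= => /andP[/eqP -> ->].
move=> [-> {}e0]; have := uy (e ^+ 2) (exprn_gt0 _ e0); apply: filterS => n.
by rewrite -[e +i* 0]/(e%:C) normE// (ltW e0).
Qed.

End L2Hilbert.

(** * Bessel, Riesz-Fischer and Fourier expansion in an orthonormal basis *)

Section OrthonormalBasis.
Context d (T : measurableType d) (R : realType) (P : probability T R).
Variables (I : choiceType) (e : I -> L2 P).
Hypothesis e_orth : forall i j, L2inner (e i) (e j) = (i == j)%:R.
Hypothesis e_total : forall x, (forall i, L2inner (e i) x = 0) -> x = 0.

Let sqn (z : R[i]) : R := ComplexField.Normc.normc z ^+ 2.

Let sqnE (z : R[i]) : sqn z = complex.Re z ^+ 2 + complex.Im z ^+ 2.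
Proof. by case: z => a b; rewrite /sqn /= sqr_sqrtr// addr_ge0 ?sqr_ge0. Qed.

Let sqn_ge0 z : 0 <= sqn z. Proof. exact: sqr_ge0. Qed.

Definition fourier_sum (a : I -> R[i]) (F : {fset I}) : L2 P :=
  \sum_(i <- F) a i *: e i.

Lemma inner_fourier_sum a F i :
  L2inner (e i) (fourier_sum a F) = if i \in F then a i else 0.
Proof.
rewrite L2inner_sumr; under eq_bigr do rewrite L2innerZr e_orth.
case: ifPn => iF.
  rewrite (big_fsetD1 i)//= eqxx mulr1 big1_seq ?addr0// => j /=.
  by rewrite !inE => /andP[/negbTE ji _]; rewrite eq_sym ji mulr0.
rewrite big1_seq// => j /= jF; rewrite (_ : i == j = false) ?mulr0//.
by apply: contraNF iF => /eqP ->.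
Qed.

Lemma inner_fourier_suml x a F :
  L2inner x (fourier_sum a F) = \sum_(i <- F) a i * (L2inner (e i) x)^*%C.
Proof.
by rewrite L2inner_sumr; apply: eq_bigr => i _; rewrite L2innerZr (L2innerC (e i) x).
Qed.

(** Pythagoras: the cross term and the squared norm of the Fourier sum are both the sum of the
    squared moduli. Only the coefficients in [F] are prescribed, so it serves for vectors and for
    larger Fourier sums alike. *)
Lemma norm2_sub_fourier_sum x a F : {in F, forall i, L2inner (e i) x = a i} ->
  norm2 (x - fourier_sum a F) = norm2 x - \sum_(i <- F) sqn (a i).
Proof.
move=> xa.
have aaE z : complex.Re (z * z^*%C) = sqn z.
  by rewrite sqnE; case: z => u v /=; ring.
have reE y : {in F, forall i, L2inner (e i) y = a i} ->
    complex.Re (L2inner y (fourier_sum a F)) = \sum_(i <- F) sqn (a i).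
  move=> ya; rewrite inner_fourier_suml raddf_sum.
  by apply: eq_big_seq => i iF; rewrite ya// -aaE.
rewrite norm2B [norm2 (fourier_sum a F)]reE ?reE//; first by ring.
by move=> i iF; rewrite inner_fourier_sum iF.
Qed.

Lemma norm2_fourier_sum a F : norm2 (fourier_sum a F) = \sum_(i <- F) sqn (a i).
Proof.
have := @norm2_sub_fourier_sum (fourier_sum a F) a F; rewrite subrr.
rewrite {1}/norm2 L2inner0r /= => /(_ _)/eqP; rewrite eq_sym subr_eq0 => h.
by apply/eqP; apply: h => i iF; rewrite inner_fourier_sum iF.
Qed.

Lemma bessel x (F : {fset I}) : \sum_(i <- F) sqn (L2inner (e i) x) <= norm2 x.
Proof.
rewrite -subr_ge0 -(@norm2_sub_fourier_sum x (fun i => L2inner (e i) x) F)//.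
exact: norm2_ge0.
Qed.

Lemma inner_le_norm2 x i : sqn (L2inner (e i) x) <= norm2 x.
Proof. by have := bessel x [fset i]%fset; rewrite big_seq_fset1. Qed.

Let sum_sqn_le a (F G : {fset I}) : (F `<=` G)%fset ->
  \sum_(i <- F) sqn (a i) <= \sum_(i <- G) sqn (a i).
Proof.
move=> FG; rewrite [leRHS](big_fsetID _ (mem F))/=.
have -> : [fset x in G | x \in F]%fset = F.
  by apply/fsetP => i; rewrite !inE andbC; case: (boolP (i \in F)) => //= /(fsubsetP FG).
by rewrite lerDl sumr_ge0.
Qed.

(** The finite sets [F n] have square sums within 1/(n+1) of the supremum, so enlarging [F n] moves
    the Fourier sum by at most that much in [norm2]. This makes the sums Cauchy, with no enumeration
    of [I]. *)
Lemma riesz_fischer a (M : R) : (forall F : {fset I}, \sum_(i <- F) sqn (a i) <= M) ->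
  exists y, (forall i, L2inner (e i) y = a i) /\
    forall eps : R, 0 < eps -> exists F, norm2 (y - fourier_sum a F) <= eps.
Proof.
move=> aM; pose S (F : {fset I}) := \sum_(i <- F) sqn (a i).
pose s := sup (range S).
have supS : has_sup (range S).
  split; first by exists (S fset0); exists fset0.
  by exists M => _ [F _ <-]; exact: aM.
have Ss F : S F <= s by apply: sup_upper_bound => //; exists F.
have exF n : exists F, s - n.+1%:R^-1 < S F.
  have [|_ [F _ <-] sF] := @sup_adherent _ (range S) n.+1%:R^-1 _ supS.
    by rewrite invr_gt0.
  by exists F.
pose F n := sval (cid (exF n)).
have sF n : s - n.+1%:R^-1 < S (F n) by exact: svalP (cid (exF n)).
pose y n := fourier_sum a (F n).
have yB m G : (F m `<=` G)%fset -> norm2 (fourier_sum a G - y m) <= m.+1%:R^-1.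
  move=> FG; rewrite norm2_sub_fourier_sum; last first.
    by move=> i iF; rewrite inner_fourier_sum (fsubsetP FG).
  rewrite norm2_fourier_sum -/(S G) -/(S (F m)) lerBlDl.
  by apply: le_trans (Ss G) _; rewrite -lerBlDr ltW.
have inv_small (eps : R) : 0 < eps -> exists N, forall n, (N <= n)%N -> n.+1%:R^-1 <= eps.
  move=> e0; exists (Num.bound eps^-1) => n nN.
  rewrite -[leRHS]invrK lef_pV2 ?posrE ?invr_gt0//.
  apply: le_trans (ltW (archi_boundP _)) _; first by rewrite invr_ge0 ltW.
  by rewrite ler_nat leqW.
have [|y0 yy0] := @L2_complete _ _ _ P y.
  move=> eps e0; have [|N Ne] := inv_small (eps / 4); first by rewrite divr_gt0.
  exists N => m n /Ne mN /Ne nN.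
  (* The two sums are compared through their union; [norm2D_le] doubles each error, hence
     [eps / 4]. *)
  pose G := (F m `|` F n)%fset.
  have -> : y m - y n = - (fourier_sum a G - y m) + (fourier_sum a G - y n).
    by rewrite opprB addrA subrK.
  apply: le_trans (norm2D_le _ _) _; rewrite norm2N.
  have := le_trans (yB m G (fsubsetUl _ _)) mN.
  by have := le_trans (yB n G (fsubsetUr _ _)) nN; lra.
exists y0; split; last first.
  by move=> eps /yy0[N /(_ _ (leqnn _))]; rewrite norm2BC => h; exists (F N).
move=> i; apply/eqP; rewrite -subr_eq0; apply/eqP.
have sqn0 z : sqn z = 0 -> z = 0.
  rewrite sqnE => /eqP; rewrite paddr_eq0 ?sqr_ge0// !sqrf_eq0.
  by case: z => u v /= /andP[/eqP -> /eqP ->].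
have sqnD z w : sqn (z + w) <= 2 * sqn z + 2 * sqn w.
  rewrite !sqnE; case: z w => [u v] [u' v'] /=.
  by have := sqr_ge0 (u - u'); have := sqr_ge0 (v - v'); nra.
apply: sqn0; apply/eqP; rewrite eq_le sqn_ge0 andbT.
apply/ler_addgt0Pl => eps e0; rewrite addr0.
have [|N Ne] := inv_small (eps / 4); first by rewrite divr_gt0.
have [|N' Ne'] := yy0 (eps / 4); first by rewrite divr_gt0.
pose n := maxn N N'.
rewrite (_ : _ - _ = L2inner (e i) (y0 - y n) + (L2inner (e i) (y n) - a i)); last first.
  by rewrite L2innerBr addrA subrK.
apply: le_trans (sqnD _ _) _.
have h1 : sqn (L2inner (e i) (y0 - y n)) <= eps / 4.
  by apply: le_trans (inner_le_norm2 _ _) _; rewrite norm2BC Ne'// leq_maxr.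
have h2 : sqn (L2inner (e i) (y n) - a i) <= eps / 4.
  apply: le_trans (Ne n (leq_maxl _ _)); rewrite inner_fourier_sum; case: ifPn => iF.
    by rewrite subrr sqnE /= expr0n/= addr0 invr_ge0.
  rewrite sub0r (_ : sqn (- a i) = sqn (a i)); last first.
    by rewrite !sqnE; case: (a i) => u v /=; rewrite !sqrrN.
  (* Adding an index outside [F n] cannot push the square sum above the supremum, so its coefficient
     is small. *)
  have := Ss (i |` F n)%fset; rewrite /S big_fsetU1//= -/(S (F n)).
  by move=> aS; rewrite -(lerD2r (S (F n))) (le_trans aS)// -lerBlDl ltW.
lra.
Qed.

(** By totality the vector rebuilt by [riesz_fischer] is [x] itself, so finite Fourier sums of [x]
    exhaust its squared norm. *)
Lemma norm2_le x (M : R) :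
  (forall F : {fset I}, \sum_(i <- F) sqn (L2inner (e i) x) <= M) -> norm2 x <= M.
Proof.
move=> xM; have [y [yx xS]] := riesz_fischer xM.
have {}yx : y = x.
  apply/eqP; rewrite -subr_eq0; apply/eqP/e_total => i.
  by rewrite L2innerBr yx subrr.
apply/ler_addgt0Pl => eps /xS[F]; rewrite yx norm2_sub_fourier_sum//.
by have := xM F; lra.
Qed.

(** The squared error is [norm2 x] minus a sum that grows with the index set, so closeness at one
    finite set persists at all larger ones. *)
Lemma fourier_cvg x (a : I -> R[i]) : (forall i, L2inner (e i) x = a i) ->
  partial_sum (fun i => a i *: e i) @ totally --> x.
Proof.
move=> xa.
have aM (F : {fset I}) : \sum_(i <- F) sqn (a i) <= norm2 x.
  by under eq_bigr do rewrite -xa; exact: bessel.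
have [y [ya yS]] := riesz_fischer aM.
have yx : y = x.
  apply/eqP; rewrite -subr_eq0; apply/eqP/e_total => i.
  by rewrite L2innerBr ya xa subrr.
have totallyF : Filter (@totally I) := @filter_filter _ _ totally_filter.
apply/cvg_norm2P => eps /yS[F]; rewrite yx norm2_sub_fourier_sum// => xF.
exists F => // G /= FG.
rewrite (_ : partial_sum _ _ = fourier_sum a G); last first.
  by rewrite /partial_sum /fourier_sum big_seq_fsetE.
rewrite norm2_sub_fourier_sum//.
by have := sum_sqn_le a FG; lra.
Qed.

End OrthonormalBasis.

(** * The eigenvalues *)

Section NonnegativeFamilies.
Context (R : realType) (I : choiceType) (a : I -> R).
Hypothesis a0 : forall i, 0 <= a i.

Lemma sum_le_esum (r : seq I) : uniq r ->
  ((\sum_(i <- r) a i)%:E <= \esum_(i in [set: I]) (a i)%:E)%E.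
Proof.
move=> ur; apply: esum_ge; exists [set` r]; first by split.
by rewrite -fsbig_seq// sumEFin.
Qed.

Lemma esum_le_bound (M : R) : (forall F : {fset I}, \sum_(i <- F) a i <= M) ->
  (\esum_(i in [set: I]) (a i)%:E <= M%:E)%E.
Proof.
move=> aM; apply: ge_ereal_sup => _ [A [/finite_fsetP[F ->] _] <-].
by rewrite -fsbig_seq ?fset_uniq// sumEFin lee_fin.
Qed.

Hypothesis afin : (\esum_(i in [set: I]) (a i)%:E < +oo)%E.

Let esum_fin : \esum_(i in [set: I]) (a i)%:E \is a fin_num.
Proof. by rewrite ge0_fin_numE// esum_ge0// => i _; rewrite lee_fin. Qed.

Lemma sum_le_fine_esum (r : seq I) : uniq r ->
  \sum_(i <- r) a i <= fine (\esum_(i in [set: I]) (a i)%:E).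
Proof. by move=> /sum_le_esum; rewrite -lee_fin fineK. Qed.

(** The form with duplicate-free lists covers intervals, squares of index pairs and finite sets
    alike. *)
Lemma esum_tail (e : R) : 0 < e -> exists F : {fset I},
  forall r : seq I, uniq r -> {subset F <= r} ->
  fine (\esum_(i in [set: I]) (a i)%:E) - e < \sum_(i <- r) a i.
Proof.
move=> e0; have [_ [A [/finite_fsetP[F ->] _] <-]] :=
  ub_ereal_sup_adherent e0 esum_fin.
rewrite -[ereal_sup _]/(\esum_(i in [set: I]) (a i)%:E) => aF; exists F => r ur Fr.
rewrite -lte_fin EFinB fineK//; apply: lt_le_trans aF _.
rewrite -sumEFin (fsbig_seq _ _ ur); apply: lee_fsum_nneg_subset => //.
  by move=> i; rewrite !inE; exact: Fr.
by move=> i _; rewrite lee_fin.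
Qed.

End NonnegativeFamilies.

Section Vartheta.
Context (R : realType) (w : nat -> nat -> R).
Hypothesis w0 : forall j k, 0 <= w j k.
Hypothesis wsup :
  (ereal_sup [set \sum_(0 <= j <oo) (w j k)%:E | k in [set: nat]] < +oo)%E.

(* The eigenvalue of w(j,k) D_k^* D_j D_j^* D_k at Z_s. *)
Definition weight_eigenvalue (s : {fset nat}) (j k : nat) : R :=
  w j k * ((k \in s) && (j \notin (s `\ k)%fset))%:R.

Definition partial_vartheta (s : {fset nat}) (n : nat) : R :=
  \sum_(j < n.+1) \sum_(k < n.+1) weight_eigenvalue s j k.

Variable s : {fset nat}.

Let diag j : R := (j \in s)%:R * w j j.
Let off (q : nat * nat) : R := (1 - (q.1 \in s)%:R) * (q.2 \in s)%:R * w q.1 q.2.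

Let diag0 j : 0 <= diag j. Proof. by rewrite mulr_ge0. Qed.

Let off0 q : 0 <= off q.
Proof. by rewrite !mulr_ge0// subr_ge0 lern1; case: (_ \in s). Qed.

Let fin_diag_off : (\esum_(j in [set: nat]) (diag j)%:E < +oo)%E /\
  (\esum_(q in [set: nat * nat]) (off q)%:E < +oo)%E.
Proof.
have h1 : (0 <= \esum_(j in [set: nat]) (diag j)%:E)%E.
  by apply: esum_ge0 => i _; rewrite lee_fin.
have h2 : (0 <= \esum_(q in [set: nat * nat]) (off q)%:E)%E.
  by apply: esum_ge0 => i _; rewrite lee_fin.
have := evartheta_fin_num s w0 wsup.
by rewrite fin_numD -!ge0_fin_numE// => /andP.
Qed.

Let varthetaE : vartheta w s = fine (\esum_(j in [set: nat]) (diag j)%:E) +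
  fine (\esum_(q in [set: nat * nat]) (off q)%:E).
Proof.
have := evartheta_fin_num s w0 wsup; rewrite fin_numD => /andP[? ?].
by rewrite /vartheta /evartheta fineD.
Qed.

Let square n := [seq (j, k) | j <- index_iota 0 n.+1, k <- index_iota 0 n.+1].

Let square_uniq n : uniq (square n).
Proof. by apply: allpairs_uniq; rewrite ?iota_uniq// => -[] ? ? [] ? ? _ _ [-> ->]. Qed.

(** For [k] in [s], the condition on [j] means that [j = k] or [j] is outside [s]. The first case
    gives [diag]; the second gives [off], which vanishes on the diagonal. *)
Let partial_varthetaE n : partial_vartheta s n =
  \sum_(j <- index_iota 0 n.+1) diag j + \sum_(q <- square n) off q.
Proof.
rewrite /square big_allpairs_dep /= /partial_vartheta [in RHS]/index_iota subn0.
rewrite -[iota 0 n.+1]/(index_iota 0 n.+1) !big_mkord -big_split /=.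
apply: eq_bigr => j _; rewrite big_mkord.
have -> : diag j = \sum_(k < n.+1) ((j : nat) == k)%:R * diag j.
  rewrite (bigD1 j)//= eqxx mul1r big1 ?addr0// => k kj.
  by rewrite (_ : (j : nat) == k = false) ?mul0r//; apply/negbTE; rewrite eq_sym.
rewrite -big_split /=; apply: eq_bigr => k _.
rewrite /weight_eigenvalue /diag /off !inE /=.
have [<-|jk] := eqVneq (j : nat) k; case: (_ \in s) => /=; rewrite ?mul1r ?mul0r; try ring.
by case: (_ \in s) => /=; ring.
Qed.

Lemma partial_vartheta_ge0 n : 0 <= partial_vartheta s n.
Proof. by rewrite partial_varthetaE addr_ge0// sumr_ge0. Qed.

Lemma partial_vartheta_le n : partial_vartheta s n <= vartheta w s.
Proof.
have [fd fo] := fin_diag_off.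
rewrite partial_varthetaE varthetaE; apply: lerD; apply: sum_le_fine_esum => //.
exact: iota_uniq.
Qed.

Lemma partial_vartheta_tail (C e : R) : 0 <= C -> 0 < e ->
  exists N, forall n, (N <= n)%N ->
    (vartheta w s - partial_vartheta s n) ^+ 2 * C <= e.
Proof.
move=> C0 e0; have [fd fo] := fin_diag_off.
have C1 : 0 < C + 1 by rewrite ltr_wpDl.
(* Chosen so that [eps ^+ 2 * (C + 1) = e]; the added 1 covers [C = 0]. *)
pose eps := Num.sqrt (e / (C + 1)).
have eps0 : 0 < eps by rewrite sqrtr_gt0 divr_gt0.
have eps20 : 0 < eps / 2 by rewrite divr_gt0.
have [F1 F1e] := esum_tail diag0 fd eps20.
have [F2 F2e] := esum_tail off0 fo eps20.
(* Beyond this bound the interval contains [F1] and the square contains [F2]. *)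
exists (maxn (\max_(j <- F1) j) (\max_(q <- F2) maxn q.1 q.2)) => n.
rewrite geq_max => /andP[n1 n2].
have h1 : {subset F1 <= index_iota 0 n.+1}.
  move=> j jF; rewrite mem_index_iota ltnS; apply: leq_trans n1.
  exact: (@leq_bigmax_seq _ (enum_fset F1) xpredT id j jF isT).
have h2 : {subset F2 <= square n}.
  move=> [j k] jkF; have jkn : (maxn j k <= n)%N.
    apply: leq_trans n2.
    exact: (@leq_bigmax_seq _ (enum_fset F2) xpredT (fun q => maxn q.1 q.2) _ jkF isT).
  move: jkn; rewrite geq_max => /andP[jn kn].
  by apply/allpairsP; exists (j, k); rewrite /= !mem_index_iota !ltnS.
have := F1e _ (iota_uniq _ _) h1; have := F2e _ (square_uniq n) h2.
have := partial_vartheta_le n; rewrite partial_varthetaE varthetaE.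
set A := fine _; set B := fine _; set S1 := \sum_(_ <- _) _; set S2 := \sum_(_ <- _) _.
move=> le0 lt2 lt1.
have d0 : 0 <= A + B - (S1 + S2) by rewrite subr_ge0.
have d1 : A + B - (S1 + S2) <= eps by move: lt1 lt2; rewrite /A /B /S1 /S2; lra.
apply: (@le_trans _ _ (eps ^+ 2 * C)).
  by apply: ler_wpM2r => //; apply: lerXn2r => //; rewrite nnegrE// ltW.
rewrite /eps sqr_sqrtr; last by rewrite divr_ge0 ?ltW.
rewrite mulrAC ler_pdivrMr// ler_pM2l// ltW//.
by rewrite ltrDl.
Qed.

End Vartheta.

(** * The weighted number operator *)

Section NumberOperator.
Context d (T : measurableType d) (R : realType) (P : probability T R).
Variables (Z : nat -> {RV P >-> R}) (p : nat -> R).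
Hypothesis p01 : forall n, 0 < p n < 1.
Hypothesis Ztheta : forall n,
  P [set x | Z n x = Bernoulli_theta p n] = (p n)%:E.
Hypothesis ZNtheta : forall n,
  P [set x | Z n x = - (Bernoulli_theta p n)^-1] = (1 - p n)%:E.
Hypothesis Zindep : independent_seq Z.
Hypothesis Zgen : @measurable d T = sigma_of_seq Z.

Let ZE := ZbasisE p01 Ztheta ZNtheta.

Lemma Zbasis_orth s t : L2inner (Zbasis Z s) (Zbasis Z t) = (s == t)%:R.
Proof.
rewrite !ZE L2inner_class /L2funinner /Cexpectation /= /Zprod.
have -> : @complex.Re R \o (fun x =>
      ((\prod_(i <- s) Z i x)%:C)^*%C * (\prod_(i <- t) Z i x)%:C) =
    (fun x => (\prod_(i <- s) Z i x) * (\prod_(i <- t) Z i x)).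
  by apply/funext => x /=; rewrite mulr0 subr0.
have -> : @complex.Im R \o (fun x =>
      ((\prod_(i <- s) Z i x)%:C)^*%C * (\prod_(i <- t) Z i x)%:C) =
    cst 0.
  by apply/funext => x /=; rewrite mulr0 oppr0 mul0r addr0.
rewrite (Zprod_inner p01 Ztheta ZNtheta Zindep) expectation_cst /=.
by case: (s == t).
Qed.

(** As the Z_s are real-valued, a vanishing inner product means that the real and imaginary parts of
    [f] are both orthogonal to Z_s. *)
Lemma Zbasis_total x : (forall s, L2inner (Zbasis Z s) x = 0) -> x = 0.
Proof.
elim/L2ind: x => f fZ.
have [rL iL] := L2predP _ _ (L2funP f).
have coefs0 (s : {fset nat}) : \int[P]_x (complex.Re (f x) * \prod_(i <- s) Z i x) = 0 /\
    \int[P]_x (complex.Im (f x) * \prod_(i <- s) Z i x) = 0.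
  have := fZ s; rewrite ZE L2inner_class /L2funinner /Cexpectation /= /Zprod unlock.
  move=> [re0 im0]; split.
    rewrite -[RHS]re0; congr fine; apply: eq_integral => x _; congr EFin.
    by rewrite /=; case: (f x) => a b /=; ring.
  rewrite -[RHS]im0; congr fine; apply: eq_integral => x _; congr EFin.
  by rewrite /=; case: (f x) => a b /=; ring.
have r0 := Zprod_total p01 Ztheta ZNtheta Zgen rL (fun s => (coefs0 s).1).
have i0 := Zprod_total p01 Ztheta ZNtheta Zgen iL (fun s => (coefs0 s).2).
have -> : 0 = L2class (0 : L2fun P) by rewrite /L2class raddf0.
apply/L2class_eq; apply: filterS2 r0 i0 => x /(_ I) /= rx /(_ I) /= ix _.
by apply/eqP; rewrite eq_complex /= rx ix eqxx.
Qed.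

Variables D Dadj : nat -> L2 P -> L2 P.
Hypothesis DZ : forall k s,
  D k (Zbasis Z s) = if k \in s then Zbasis Z (s `\ k)%fset else 0.
Hypothesis Dadjoint : forall k, is_adjoint (D k) (Dadj k).

(** Moving the operator onto the basis vector gives the coefficients for every [x], without
    expanding [x]. *)
Lemma inner_Dadj k s x : L2inner (Zbasis Z s) (Dadj k x) =
  if k \in s then L2inner (Zbasis Z (s `\ k)%fset) x else 0.
Proof.
rewrite (L2innerC (Dadj k x)) Dadjoint DZ; case: ifP => _.
  by rewrite -L2innerC.
by rewrite L2inner0r conjc0.
Qed.

(** By totality it suffices to compare coefficients: [t] containing [k] satisfies t \ {k} = s
    exactly when [k] is not in [s] and [t] is [s] with [k] added. *)
Lemma DadjZ k s :
  Dadj k (Zbasis Z s) = if k \in s then 0 else Zbasis Z (k |` s)%fset.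
Proof.
apply/eqP; rewrite -subr_eq0; apply/eqP/Zbasis_total => t.
rewrite L2innerBr inner_Dadj [in X in X - _]Zbasis_orth.
have [ks|kNs] := boolP (k \in s).
  rewrite L2inner0r subr0; case: ifP => // kt.
  rewrite (_ : (t `\ k)%fset == s = false)//; apply/negbTE.
  by apply: contraTneq ks => <-; rewrite !inE eqxx.
rewrite Zbasis_orth; case: ifPn => kt.
  rewrite (_ : (t == (k |` s)%fset) = ((t `\ k)%fset == s)) ?subrr//.
  apply/eqP/eqP => [->|<-]; first by rewrite fsetU1K.
  by rewrite fsetD1K.
rewrite (_ : t == (k |` s)%fset = false) ?subrr//; apply/negbTE.
by apply: contraNneq kt => ->; rewrite !inE eqxx.
Qed.

Lemma inner_D k s x : L2inner (Zbasis Z s) (D k x) =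
  if k \in s then 0 else L2inner (Zbasis Z (k |` s)%fset) x.
Proof.
rewrite -Dadjoint DadjZ; case: ifP => // _.
by rewrite (L2innerC x 0) L2inner0r conjc0.
Qed.

Variable w : nat -> nat -> R.

(** Peeling the operators from the outside, the index set goes from [s] to s \ {k}, gains [j], loses
    [j] and regains [k]. The first two moves require [k] in [s] and [j] outside s \ {k}. *)
Lemma inner_Sw_term x j k s : L2inner (Zbasis Z s) (Sw_term D Dadj w x j k) =
  (weight_eigenvalue w s j k)%:C * L2inner (Zbasis Z s) x.
Proof.
rewrite /Sw_term L2innerZr inner_Dadj /weight_eigenvalue.
case: ifPn => [ks|_] /=; last by rewrite !mulr0 mul0r.
rewrite inner_D; case: ifPn => [_|js] /=; first by rewrite !mulr0 mul0r.
rewrite inner_Dadj !inE eqxx /= mulr1.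
rewrite fsetU1K// inner_D !inE eqxx /= fsetD1K//.
Qed.

Lemma inner_square_partial_sum x n s :
  L2inner (Zbasis Z s) (square_partial_sum (Sw_term D Dadj w x) n) =
  (partial_vartheta w s n)%:C * L2inner (Zbasis Z s) x.
Proof.
rewrite /square_partial_sum L2inner_sumr /partial_vartheta raddf_sum mulr_suml.
apply: eq_bigr => j _; rewrite L2inner_sumr raddf_sum mulr_suml.
by apply: eq_bigr => k _; exact: inner_Sw_term.
Qed.

End NumberOperator.

(** * Squared moduli of complex numbers *)

Section SquareNormc.
Context (R : realType).
Implicit Types (z u : R[i]) (a : R).

Lemma sqr_normcZ a z : ComplexField.Normc.normc (a%:C * z) ^+ 2 =
  a ^+ 2 * ComplexField.Normc.normc z ^+ 2.
Proof.
by rewrite ComplexField.Normc.normcM exprMn /= expr0n/= addr0 sqrtr_sqr real_normK ?num_real.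
Qed.

Lemma sqr_normcD_le z u : ComplexField.Normc.normc (z + u) ^+ 2 <=
  2 * ComplexField.Normc.normc z ^+ 2 + 2 * ComplexField.Normc.normc u ^+ 2.
Proof.
case: z u => [a b] [a' b']; rewrite /= !sqr_sqrtr ?addr_ge0 ?sqr_ge0//.
by have := sqr_ge0 (a - a'); have := sqr_ge0 (b - b'); lra.
Qed.

Lemma sqr_normc_eq0 z : ComplexField.Normc.normc z ^+ 2 <= 0 -> z = 0.
Proof.
move=> z0; apply: ComplexField.Normc.eq0_normc; apply/eqP.
by rewrite -sqrf_eq0 eq_le z0 sqr_ge0.
Qed.

End SquareNormc.

(** * The domain and the diagonal form of the operator *)

Local Open Scope fset_scope.
Local Open Scope ring_scope.
Local Open Scope complex_scope.

Theorem theorem4p2 (R : realType) (d : measure_display) (T : measurableType d)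
    (P : probability T R) (Z : nat -> {RV P >-> R}) (p : nat -> R)
    (p01 : forall n, 0 < p n < 1)
    (Ztheta : forall n,
       P [set x | Z n x = Bernoulli_theta p n] = (p n)%:E)
    (ZNtheta : forall n,
       P [set x | Z n x = - (Bernoulli_theta p n)^-1] = (1 - p n)%:E)
    (Zindep : independent_seq Z)
    (Zgen : @measurable d T = sigma_of_seq Z)
    (D Dadj : nat -> L2 P -> L2 P)
    (Dbounded : forall k, bounded_operator (D k))
    (DZ : forall k s,
       D k (Zbasis Z s) = if k \in s then Zbasis Z (s `\ k) else 0)
    (Dadjoint : forall k, is_adjoint (D k) (Dadj k))
    (w : nat -> nat -> R)
    (w0 : forall j k, 0 <= w j k)
    (wsup : (ereal_sup [set \sum_(0 <= j <oo) (w j k)%:E | k in [set: nat]]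
             < +oo)%E)
    (xi : L2 P) :
  (DomSw D Dadj w xi <->
   (\esum_(s in [set: {fset nat}])
      ((vartheta w s) ^+ 2 * ComplexField.Normc.normc (L2inner (Zbasis Z s) xi) ^+ 2)%:E
    < +oo)%E) /\
  (DomSw D Dadj w xi ->
   partial_sum (fun s : {fset nat} =>
     ((vartheta w s)%:C * L2inner (Zbasis Z s) xi) *: Zbasis Z s) @ totally
   --> Sw D Dadj w xi).
Proof.
have orth := Zbasis_orth p01 Ztheta ZNtheta Zindep.
have total := Zbasis_total p01 Ztheta ZNtheta Zgen.
pose c s := L2inner (Zbasis Z s) xi.
pose C s := ComplexField.Normc.normc (c s) ^+ 2.
have C0 s : 0 <= C s by exact: sqr_ge0.
pose sq := square_partial_sum (Sw_term D Dadj w xi).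
pose a s := (vartheta w s)%:C * c s.
have sqE n s : L2inner (Zbasis Z s) (sq n) = (partial_vartheta w s n)%:C * c s.
  exact: (inner_square_partial_sum p01 Ztheta ZNtheta Zindep Zgen DZ Dadjoint).
have tail s e : 0 < e -> exists N, forall n, (N <= n)%N ->
    (vartheta w s - partial_vartheta w s n) ^+ 2 * C s <= e.
  exact: partial_vartheta_tail.
have aC s : ComplexField.Normc.normc (a s) ^+ 2 = vartheta w s ^+ 2 * C s.
  exact: sqr_normcZ.
(* Coefficients are continuous by Bessel's inequality, and those of [sq n] tend to [a s] by
   [tail]. *)
have limit_inner y s : sq @ \oo --> y -> L2inner (Zbasis Z s) y = a s.
  move=> /cvg_norm2P sqy; apply/eqP; rewrite -subr_eq0; apply/eqP/sqr_normc_eq0.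
  apply/ler_addgt0Pl => e e0; rewrite addr0.
  have e40 : 0 < e / 4 by rewrite divr_gt0.
  have [N1 _ sqN] := sqy _ e40; have [N2 tN] := tail s _ e40.
  have /sqN := leq_maxl N1 N2; have /tN := leq_maxr N1 N2; set n := maxn N1 N2.
  move=> h1 h2.
  rewrite (_ : _ - _ = (L2inner (Zbasis Z s) (y - sq n) +
      (- (vartheta w s - partial_vartheta w s n))%:C * c s)%R); last first.
    by rewrite L2innerBr sqE rmorphN rmorphB /= /a; ring.
  apply: le_trans (sqr_normcD_le _ _) _; rewrite sqr_normcZ sqrrN.
  have h3 := le_trans (inner_le_norm2 orth (y - sq n) s) h2.
  by move: h1 h3; rewrite /C; lra.
have domP : DomSw D Dadj w xi -> sq @ \oo --> Sw D Dadj w xi by [].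
split; last first.
  by move=> /domP sqS; apply: (fourier_cvg orth total) => s; exact: limit_inner.
have g0 s : 0 <= vartheta w s ^+ 2 * C s by rewrite mulr_ge0 ?sqr_ge0.
split=> [/domP sqS|fin].
  apply: le_lt_trans (esum_le_bound _) (ltry (norm2 (Sw D Dadj w xi))) => F.
  apply: le_trans (bessel orth _ F); apply: ler_sum => s _.
  by rewrite (limit_inner _ _ sqS) aC.
have aM (F : {fset {fset nat}}) :
    \sum_(s <- F) ComplexField.Normc.normc (a s) ^+ 2 <=
    fine (\esum_(s in [set: {fset nat}]) (vartheta w s ^+ 2 * C s)%:E).
  under eq_bigr do rewrite aC.
  exact: sum_le_fine_esum.
have [y [ya _]] := riesz_fischer orth aM.
apply/cvg_ex; exists y; apply/cvg_norm2P => e e0.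
have e20 : 0 < e / 2 by rewrite divr_gt0.
have [F Ftail] := esum_tail g0 fin e20.
(* Half of [e] is shared among the elements of [F]; the successor keeps the denominator positive
   when [F] is empty. *)
pose eF := e / 2 / (size F).+1%:R.
have eF0 : 0 < eF by rewrite divr_gt0.
pose N s := sval (cid (tail s _ eF0)).
have NP s n : (N s <= n)%N ->
    (vartheta w s - partial_vartheta w s n) ^+ 2 * C s <= eF.
  exact: (svalP (cid (tail s _ eF0))).
exists (\max_(s <- F) N s)%N => // n /= Nn.
(* By Parseval it is enough to bound finite sums: inside [F] each term is at most [eF], outside [F]
   the terms are dominated by the tail of the convergent family. *)
apply: (norm2_le orth total) => G.
pose f s := (vartheta w s - partial_vartheta w s n) ^+ 2 * C s.
have f0 s : 0 <= f s by rewrite mulr_ge0 ?sqr_ge0.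
have fg s : f s <= vartheta w s ^+ 2 * C s.
  apply: ler_wpM2r => //; apply: lerXn2r; rewrite ?nnegrE ?subr_ge0 ?partial_vartheta_le//.
    exact: le_trans (partial_vartheta_ge0 w0 s 0) (partial_vartheta_le w0 wsup s 0).
  by rewrite gerBl partial_vartheta_ge0.
rewrite (eq_bigr f); last first.
  by move=> s _; rewrite L2innerBr ya sqE /a -mulrBl -rmorphB sqr_normcZ.
(* Enlarging [G] to contain [F] lets the part outside [F] be bounded as a sum over [H] minus the sum
   over [F]. *)
pose H := F `|` G.
have FH : [fset s in H | s \in F] = F.
  by apply/fsetP => s; rewrite /H !inE andbC; case: (s \in F).
have GH : \sum_(s <- G) f s <= \sum_(s <- H) f s.
  rewrite [leRHS](big_fsetID _ (mem G))/=.
  have -> : [fset s in H | s \in G] = G.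
    by apply/fsetP => s; rewrite /H !inE andbC; case: (s \in G); rewrite ?orbT.
  by rewrite lerDl sumr_ge0.
apply: le_trans GH _.
rewrite (big_fsetID _ (mem F))/= FH [leRHS]splitr; apply: lerD.
  apply: (@le_trans _ _ (\sum_(s <- F) eF)).
    rewrite big_seq [leRHS]big_seq; apply: ler_sum => s sF; apply: NP.
    by apply: leq_trans Nn; exact: (@leq_bigmax_seq _ (enum_fset F) xpredT N s sF isT).
  rewrite big_const_seq count_predT iter_addr_0 -[leLHS]mulr_natr /eF mulrAC.
  by rewrite ler_pdivrMr// ler_pM2l// ler_nat.
(* The sum over [H] is at most the total, and the sum over [F] falls short of it by less than
   [e / 2]. *)
apply: le_trans (ler_sum _ (fun s _ => fg s)) _.
have := sum_le_fine_esum g0 fin (fset_uniq H).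
rewrite (big_fsetID _ (mem F))/= FH.
have := Ftail F (fset_uniq F) (fun _ h => h).
by set A := \sum_(_ <- F) _; set B := \sum_(_ <- _) _; set E := fine _; lra.
Qed.
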